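(* There is an algorithm that, given a hypergraph $(V,\mathcal{H})$ with $n=|V|$ vertices, $m=|\mathcal{H}|$ edges and maximum degree $\Delta$, together with an integer $k\ge 2$, decides whether the transversal rank of $\mathcal{H}$ is at least $k$ (and, if so, outputs a minimal hitting set of $\mathcal{H}$ with at least $k$ vertices) in time $O(\Delta^{k-2}\, m\, n^{k-1})$. For $k<2$ the same task can be solved in time $O(mn)$.
   Context: A hypergraph is a finite vertex set $V$ with a collection $\mathcal{H}\subseteq 2^V$ of edges. The degree of $v$ is the number of edges containing $v$; $\Delta=\max_v \deg(v)$. A hitting set (transversal) is a set $T\subseteq V$ with $T\cap E\neq\emptyset$ for all $E\in\mathcal{H}$; it is minimal if no proper subset is a hitting set. $\mathrm{Tr}(\mathcal{H})$ denotes the set of minimal hitting sets, and the transversal rank of $\mathcal{H}$ is $\max_{T\in \mathrm{Tr}(\mathcal{H})}|T|$. *)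

(* Defs.v *)
From mathcomp Require Import all_boot all_order.
Set Implicit Arguments. Unset Strict Implicit. Unset Printing Implicit Defensive.

Section Hyper.
Variable n : nat.
Implicit Types (H : {set {set 'I_n}}) (T : {set 'I_n}).

Definition hdeg H (v : 'I_n) : nat := #|[set E in H | v \in E]|.
Definition hmaxdeg H : nat := \max_(v : 'I_n) hdeg H v.
Definition hitting H T : Prop := forall E, E \in H -> T :&: E != set0.
Definition minimal_hitting H T : Prop :=
  hitting H T /\ forall T', T' \proper T -> ~ hitting H T'.
(* transversal rank = max size of a minimal hitting set *)
Definition transversal_rank_ge H (k : nat) : Prop :=
  exists T, minimal_hitting H T /\ k <= #|T|.
End Hyper.

(* Model of computation: unit-cost RAM with addition, truncated        *)
(* subtraction, comparison, and indirect addressing; memory nat->nat.  *)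
Inductive instr : Type :=
| IConst of nat & nat
| IAdd of nat & nat & nat
| ISub of nat & nat & nat
| ILoad of nat & nat
| IStore of nat & nat
| IJlt of nat & nat & nat
| IJmp of nat
| IHalt.

Definition program := seq instr.
Definition memory := nat -> nat.

Definition upd (M : memory) (a v : nat) : memory :=
  fun i => if i == a then v else M i.

Definition step (p : program) (c : nat * memory) : option (nat * memory) :=
  let: (pc, M) := c in
  if pc < size p then
    match nth IHalt p pc with
    | IConst d v => Some (pc.+1, upd M d v)
    | IAdd d a b => Some (pc.+1, upd M d (M a + M b))
    | ISub d a b => Some (pc.+1, upd M d (M a - M b))
    | ILoad d a => Some (pc.+1, upd M d (M (M a)))
    | IStore a s => Some (pc.+1, upd M (M a) (M s))
    | IJlt a b t => Some (if M a < M b then t else pc.+1, M)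
    | IJmp t => Some (t, M)
    | IHalt => None
    end
  else None.

Fixpoint run (p : program) (t : nat) (c : nat * memory) : option memory :=
  match step p c with
  | None => Some c.2
  | Some c' => if t is t'.+1 then run p t' c' else None
  end.

Definition init_mem (l : seq nat) : memory := fun i => nth 0 l i.

Definition encode_input (n k : nat) (es : seq (seq 'I_n)) : seq nat :=
  [:: n; k; size es] ++ flatten [seq size e :: map (@nat_of_ord n) e | e <- es].

Definition represents (n : nat) (es : seq (seq 'I_n)) (H : {set {set 'I_n}})
  : Prop :=
  [/\ all uniq es,
      uniq [seq [set x in e] | e <- es] &
      H = [set E in [seq [set x in e] | e <- es]]].

Definition output_set (M : memory) : seq nat := mkseq (fun i => M i.+2) (M 1).

Definition correct_output (n k : nat) (H : {set {set 'I_n}}) (M : memory)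
  : Prop :=
  (M 0 = 1 \/ M 0 = 0) /\
  (M 0 = 1 <-> transversal_rank_ge H k) /\
  (M 0 = 1 -> exists T : {set 'I_n},
      [/\ uniq (output_set M),
          (forall x, x \in output_set M -> x < n),
          [set x : 'I_n | nat_of_ord x \in output_set M] = T,
          minimal_hitting H T & k <= #|T|]).

Definition time_bound (n m Delta k : nat) : nat :=
  if 2 <= k then Delta ^ (k - 2) * m * n ^ (k - 1) else m * n.

(* Main.v *)
Require Import Defs.
From mathcomp Require Import all_boot all_order.
From mathcomp Require Import zify.
Set Implicit Arguments. Unset Strict Implicit. Unset Printing Implicit Defensive.

(* A minimal hitting set T with at least k >= 2 vertices contains q = k - 2     *)
(* vertices v_i, each with a private edge E_i that meets T in v_i only. There   *)
(* are at most (n Delta)^q tuples of incidences (v_i, E_i), and each is tested  *)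
(* in time O(mn): let S = {v_i}, call an edge free if it avoids S, and extend S *)
(* by the vertices that lie in no E_i and miss some free edge. If the result    *)
(* hits every edge, then shrinking it greedily keeps S (because of the E_i) and *)
(* at least two more vertices: a single further vertex would lie in all free    *)
(* edges. For k < 2 the tuple is empty and one starts from all vertices.        *)
(*                                                                              *)
(* On the RAM, the input fills memory from cell 0 on, so no cell is free at the *)
(* start. But n is redundant, since isolated vertices are in no minimal hitting *)
(* set; and k <= m may be assumed, so that the pair (k, m) packs into the       *)
(* single number m(m+1)/2 + k in time O(m) with one spare cell. The three cells *)
(* 0, 1, 2 then suffice to walk to the first empty edge or to the end of the    *)
(* input and to move the low cells above it.                                    *)
(** * Structured programs *)

(** A hitting set is minimal exactly when each of its vertices has a private edge
    ([minimal_hitting_indic]), so everything is phrased with [hits] and [critical]. Private edges of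
    distinct vertices differ, so a solution has at most m vertices ([critical_nverts]) and k > m is
    rejected at once.

    Let k >= 2, q = k - 2, and let b be the number of incidences. Any q vertices of a solution, with
    private edges, determine a candidate set that contains the solution. Every hitting set inside
    the candidate has at least k vertices: a chosen private edge can only be hit by its own vertex,
    and an unchosen vertex that hits one free edge misses another, which forces a second unchosen
    vertex ([extend_complete]). Conversely, [success] measures the shrunken set itself, so a
    positive test is sound for every tuple ([success_sound]). Trying all b^q tuples, numbered in
    base b ([digit_surj], [tri_search]), therefore decides the question. Since b <= n Delta
    ([sum_incident]) and a test costs O(mn), the total is (n Delta)^q m n = Delta^(k-2) m n^(k-1).

    The cost is carried to the RAM in layers. Programs are written in [hcmd], whose semantics [hrun]
    computes the final state and a cost, and are verified with the triples [tri]. [comp_ok]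
    translates them to [cmd], where [runs] bounds the number of machine steps, and [run_code] turns
    a [cmd] into jumps. Handling the input costs O(m max(n, 1)), which the time bound absorbs
    ([time_bound_ge]). *)

Inductive cmd : Type :=
| CConst of nat & nat
| CAdd of nat & nat & nat
| CSub of nat & nat & nat
| CLoad of nat & nat
| CStore of nat & nat
| CSkip
| CSeq of cmd & cmd
| CIf of nat & nat & cmd & cmd
| CWhile of nat & nat & cmd.

Declare Scope cmd_scope.
Delimit Scope cmd_scope with C.
Bind Scope cmd_scope with cmd.
Notation "c1 ;; c2" := (CSeq c1 c2)
  (at level 90, right associativity) : cmd_scope.
Local Open Scope cmd_scope.

(** The second index counts machine instructions: the branch that is not jumped to pays for a jump
    over the other one, and each loop round pays for its test and the jump back. *)
Inductive ev : cmd -> memory -> nat -> memory -> Prop :=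
| EvConst d v M : ev (CConst d v) M 1 (upd M d v)
| EvAdd d a b M : ev (CAdd d a b) M 1 (upd M d (M a + M b))
| EvSub d a b M : ev (CSub d a b) M 1 (upd M d (M a - M b))
| EvLoad d a M : ev (CLoad d a) M 1 (upd M d (M (M a)))
| EvStore a s M : ev (CStore a s) M 1 (upd M (M a) (M s))
| EvSkip M : ev CSkip M 0 M
| EvSeq c1 c2 M t1 M1 t2 M2 :
    ev c1 M t1 M1 -> ev c2 M1 t2 M2 -> ev (c1 ;; c2) M (t1 + t2) M2
| EvIfT a b c1 c2 M t M' :
    M a < M b -> ev c1 M t M' -> ev (CIf a b c1 c2) M t.+1 M'
| EvIfF a b c1 c2 M t M' :
    M b <= M a -> ev c2 M t M' -> ev (CIf a b c1 c2) M t.+2 M'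
| EvWhileT a b c M t1 M1 t2 M2 :
    M a < M b -> ev c M t1 M1 -> ev (CWhile a b c) M1 t2 M2 ->
    ev (CWhile a b c) M (t1 + 2 + t2) M2
| EvWhileF a b c M : M b <= M a -> ev (CWhile a b c) M 2 M.

Fixpoint csize (c : cmd) : nat :=
  match c with
  | CSkip => 0
  | CSeq c1 c2 => csize c1 + csize c2
  | CIf _ _ c1 c2 => (csize c2 + csize c1).+2
  | CWhile _ _ c => (csize c).+3
  | _ => 1
  end.

(** Jump targets are absolute, hence the load address [o]. The else branch comes first because a
    failed [IJlt] falls through. *)
Fixpoint code (c : cmd) (o : nat) : program :=
  match c with
  | CConst d v => [:: IConst d v]
  | CAdd d a b => [:: IAdd d a b]
  | CSub d a b => [:: ISub d a b]
  | CLoad d a => [:: ILoad d a]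
  | CStore a s => [:: IStore a s]
  | CSkip => [::]
  | CSeq c1 c2 => code c1 o ++ code c2 (o + csize c1)
  | CIf a b c1 c2 =>
      IJlt a b (o + csize c2).+2 :: code c2 o.+1 ++
      IJmp (o + csize c2 + csize c1).+2 :: code c1 (o + csize c2).+2
  | CWhile a b c =>
      [:: IJlt a b o.+2, IJmp (o + csize c).+3 & code c o.+2 ++ [:: IJmp o]]
  end.

Lemma size_code c o : size (code c o) = csize c.
Proof.
elim: c o => //= [c1 IH1 c2 IH2|a b c1 IH1 c2 IH2|a b c IH] o.
- by rewrite size_cat IH1 IH2.
- by rewrite size_cat /= IH1 IH2 addnS.
- by rewrite size_cat IH addn1.
Qed.

Definition istep (i : instr) (pc : nat) (M : memory) : option (nat * memory) :=
  match i with
  | IConst d v => Some (pc.+1, upd M d v)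
  | IAdd d a b => Some (pc.+1, upd M d (M a + M b))
  | ISub d a b => Some (pc.+1, upd M d (M a - M b))
  | ILoad d a => Some (pc.+1, upd M d (M (M a)))
  | IStore a s => Some (pc.+1, upd M (M a) (M s))
  | IJlt a b t => Some (if M a < M b then t else pc.+1, M)
  | IJmp t => Some (t, M)
  | IHalt => None
  end.

Lemma run_at p pre i post u o M : p = pre ++ i :: post -> o = size pre ->
  run p u.+1 (o, M) = if istep i o M is Some c then run p u c else Some M.
Proof.
move=> -> ->; rewrite /= size_cat /= nth_cat ltnn subnn /=.
by rewrite -{1}(addn0 (size pre)) ltn_add2l /=; case: i.
Qed.

(** The surplus fuel [u] and the surrounding [pre], [post] make the statement compose along
    sequences, branches and loops. *)
Lemma code_ev c M t M' : ev c M t M' -> forall p pre post o u,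
  p = pre ++ code c o ++ post -> o = size pre ->
  run p (t + u) (o, M) = run p u (o + csize c, M').
Proof.
elim=> {c M t M'}.
- by move=> d v M p pre post o u e eo; rewrite add1n (run_at _ _ e eo) addn1.
- by move=> d a b M p pre post o u e eo; rewrite add1n (run_at _ _ e eo) addn1.
- by move=> d a b M p pre post o u e eo; rewrite add1n (run_at _ _ e eo) addn1.
- by move=> d a M p pre post o u e eo; rewrite add1n (run_at _ _ e eo) addn1.
- by move=> a s M p pre post o u e eo; rewrite add1n (run_at _ _ e eo) addn1.
- by move=> M p pre post o u _ _; rewrite addn0.
- move=> c1 c2 M t1 M1 t2 M2 _ IH1 _ IH2 p pre post o u e eo.
  rewrite -catA in e; rewrite -addnA (IH1 _ _ _ _ _ e eo) addnA.
  rewrite catA in e; apply: IH2 e _; by rewrite size_cat size_code eo.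
- move=> a b c1 c2 M t M' lt _ IH p pre post o u e eo.
  rewrite addSn (run_at _ _ e eo) /istep lt.
  rewrite /= -!catA /= -cat_rcons catA -cat_rcons in e.
  rewrite (IH _ _ _ _ _ e); first by congr (run _ _ (_, _)) => /=; lia.
  by rewrite !(size_cat, size_rcons, size_code); lia.
- move=> a b c1 c2 M t M' le _ IH p pre post o u e eo.
  rewrite !addSn (run_at _ _ e eo) /istep ltnNge le.
  rewrite /= -!catA /= -cat_rcons in e; rewrite -addnS.
  rewrite (IH _ _ _ _ _ e); last by rewrite size_rcons eo.
  rewrite catA in e; rewrite (run_at _ _ e) /istep.
    by congr (run _ _ (_, _)) => /=; lia.
  by rewrite size_cat size_rcons size_code; lia.
- move=> a b c M t1 M1 t2 M2 lt _ IH1 _ IH2 p pre post o u e eo.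
  rewrite -(IH2 _ _ _ _ u e eo).
  have -> : t1 + 2 + t2 + u = (t1 + (t2 + u).+1).+1 by lia.
  rewrite (run_at _ _ e eo) /istep lt.
  rewrite /= -!catA /= -cat_rcons -cat_rcons in e.
  rewrite (IH1 _ _ _ _ _ e); last by rewrite !size_rcons eo.
  rewrite catA in e; rewrite (run_at _ _ e) //.
  by rewrite size_cat !size_rcons size_code; lia.
- move=> a b c M le p pre post o u e eo.
  rewrite !addSn (run_at _ _ e eo) /istep ltnNge le.
  rewrite /= -cat_rcons in e; rewrite (run_at _ _ e) /istep; last by rewrite size_rcons eo.
  by rewrite !addnS.
Qed.

Lemma run_code c M t M' : ev c M t M' -> run (code c 0) t (0, M) = Some M'.
Proof.
move=> h; have e : code c 0 = [::] ++ code c 0 ++ [::] by rewrite cats0.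
have := code_ev h 0 e erefl; rewrite addn0 => ->.
by rewrite /= size_code ltnn.
Qed.

Definition runs (c : cmd) (M : memory) (T : nat) (Q : memory -> Prop) : Prop :=
  exists t M', [/\ ev c M t M', t <= T & Q M'].

Lemma runs_weaken c M T T' (Q Q' : memory -> Prop) :
  runs c M T Q -> T <= T' -> (forall M', Q M' -> Q' M') -> runs c M T' Q'.
Proof.
by move=> [t [M' [e le q]]] le' imp; exists t, M'; split; [|lia|apply: imp].
Qed.

Lemma runs_seq c1 c2 M T1 T2 Q :
  runs c1 M T1 (fun M1 => runs c2 M1 T2 Q) -> runs (c1 ;; c2) M (T1 + T2) Q.
Proof.
move=> [t1 [M1 [e1 l1 [t2 [M2 [e2 l2 q]]]]]].
by exists (t1 + t2), M2; split; [apply: EvSeq e1 e2|lia|].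
Qed.

Lemma runs_const d v M (Q : memory -> Prop) :
  Q (upd M d v) -> runs (CConst d v) M 1 Q.
Proof. by move=> q; exists 1, (upd M d v); split=> //; constructor. Qed.

Lemma runs_add d a b M (Q : memory -> Prop) :
  Q (upd M d (M a + M b)) -> runs (CAdd d a b) M 1 Q.
Proof. by move=> q; exists 1, (upd M d (M a + M b)); split=> //; constructor. Qed.

Lemma runs_sub d a b M (Q : memory -> Prop) :
  Q (upd M d (M a - M b)) -> runs (CSub d a b) M 1 Q.
Proof. by move=> q; exists 1, (upd M d (M a - M b)); split=> //; constructor. Qed.

Lemma runs_load d a M (Q : memory -> Prop) :
  Q (upd M d (M (M a))) -> runs (CLoad d a) M 1 Q.
Proof. by move=> q; exists 1, (upd M d (M (M a))); split=> //; constructor. Qed.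

Lemma runs_store a s M (Q : memory -> Prop) :
  Q (upd M (M a) (M s)) -> runs (CStore a s) M 1 Q.
Proof. by move=> q; exists 1, (upd M (M a) (M s)); split=> //; constructor. Qed.

Lemma runs_skip M (Q : memory -> Prop) : Q M -> runs CSkip M 0 Q.
Proof. by move=> q; exists 0, M; split=> //; constructor. Qed.

Lemma runs_if a b c1 c2 M T Q :
  (M a < M b -> runs c1 M T Q) -> (M b <= M a -> runs c2 M T Q) ->
  runs (CIf a b c1 c2) M T.+2 Q.
Proof.
move=> h1 h2; case: (ltnP (M a) (M b)) => c.
- by have [t [M' [e l q]]] := h1 c; exists t.+1, M'; split; [exact: EvIfT|lia|].
- by have [t [M' [e l q]]] := h2 c; exists t.+2, M'; split; [exact: EvIfF|lia|].
Qed.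

(** The number [B] of rounds is fixed beforehand, so termination needs no separate measure; the
    induction runs on the rounds that remain. *)
Lemma runs_while a b c (J : nat -> memory -> Prop) (f : nat -> nat) B M
    (Q : memory -> Prop) :
  J 0 M ->
  (forall j M', j < B -> J j M' -> M' a < M' b /\ runs c M' (f j) (J j.+1)) ->
  (forall M', J B M' -> M' b <= M' a /\ Q M') ->
  runs (CWhile a b c) M (\sum_(j < B) (f j + 2) + 2) Q.
Proof.
move=> J0 stepJ endJ.
suff H r M' : r <= B -> J (B - r) M' ->
    runs (CWhile a b c) M' (\sum_(B - r <= j < B) (f j + 2) + 2) Q.
  by have := H B M (leqnn B); rewrite subnn big_mkord; apply.
elim: r M' => [|r IH] M' ler.
  rewrite subn0 => /endJ [le q]; exists 2, M'; split=> //; last by lia.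
  exact: EvWhileF.
move=> Jr; have lt : B - r.+1 < B by lia.
have [ltab [t1 [M1 [e1 l1 J1]]]] := stepJ _ _ lt Jr.
move: J1; rewrite -subSn // subSS => /IH [|t2 [M2 [e2 l2 q]]]; first by lia.
exists (t1 + 2 + t2), M2; split=> //; first exact: EvWhileT e1 e2.
rewrite big_ltn // -subSn // subSS; lia.
Qed.

(** * Variables, arrays and expressions *)

Definition state : Type := ((nat -> nat) * (nat -> nat -> nat))%type.
Definition setr (s : state) x v : state := (upd s.1 x v, s.2).
Definition seta (s : state) a i v : state :=
  (s.1, fun b j => if (b == a) && (j == i) then v else s.2 b j).

(** On 0/1 values [ESum] serves as counting and as bounded quantification, so most inner loops of
    the algorithm are expressions. *)
Inductive expr : Type :=
| EC of nat
| EV of nat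
| EAdd of expr & expr
| ESub of expr & expr
| EGet of nat & expr
| ESum of nat & expr & expr.

Fixpoint eval (e : expr) (s : state) : nat :=
  match e with
  | EC v => v
  | EV x => s.1 x
  | EAdd a b => eval a s + eval b s
  | ESub a b => eval a s - eval b s
  | EGet a e => s.2 a (eval e s)
  | ESum i b e => \sum_(j < eval b s) eval e (setr s i j)
  end.

(** The constants are the instruction counts of [comp_expr]: 8 for an array access is 7 for [addr]
    and 1 for the load. *)
Fixpoint ecost (e : expr) (s : state) : nat :=
  match e with
  | EC _ => 1
  | EV _ => 2
  | EAdd a b | ESub a b => ecost a s + ecost b s + 1
  | EGet _ e => ecost e s + 8
  | ESum i b e => ecost b s + \sum_(j < eval b s) (ecost e (setr s i j) + 7) + 8
  end.

Inductive hcmd : Type :=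
| HSet of nat & expr
| HPut of nat & expr & expr
| HSeq of hcmd & hcmd
| HIf of expr & expr & hcmd & hcmd
| HFor of nat & expr & hcmd.

Fixpoint hrun (c : hcmd) (s : state) : state * nat :=
  match c with
  | HSet x e => (setr s x (eval e s), ecost e s + 2)
  | HPut a i e => (seta s a (eval i s) (eval e s), ecost i s + ecost e s + 8)
  | HSeq c1 c2 =>
      let r1 := hrun c1 s in let r2 := hrun c2 r1.1 in (r2.1, r1.2 + r2.2)
  | HIf a b c1 c2 =>
      let r := if eval a s < eval b s then hrun c1 s else hrun c2 s in
      (r.1, ecost a s + ecost b s + r.2 + 2)
  | HFor i b c =>
      let r := foldl (fun r j => let r' := hrun c (setr r.1 i j) in
                                 (r'.1, r.2 + r'.2 + 6))
                     (s, 0) (iota 0 (eval b s)) in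
      (r.1, ecost b s + r.2 + 3)
  end.

(* Cells 0-31 hold the program variables, cell 32 the base address of the     *)
(* arrays and cells 33-63 temporaries; the sixteen arrays are interleaved     *)
(* above the base, so that each of them is unbounded.                         *)
Definition stored (base : nat) (s : state) (M : memory) : Prop :=
  [/\ M 32 = base,
      forall x, x < 32 -> M x = s.1 x &
      forall a i, a < 16 -> M (base + 16 * i + a) = s.2 a i].

Definition copy d a := CConst d 0 ;; CAdd d d a.
(** Multiplication by 16 is four doublings, as the machine only adds. *)
Definition addr t a :=
  CAdd t t t ;; CAdd t t t ;; CAdd t t t ;; CAdd t t t ;;
  CAdd t t 32 ;; CConst t.+1 a ;; CAdd t t t.+1.

(** A sum uses the cell of its bound variable as counter value; the old value waits in [t.+3] and is
    put back, so evaluation has no side effect on variables. *)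
Fixpoint comp_expr (e : expr) (t : nat) : cmd :=
  match e with
  | EC v => CConst t v
  | EV x => copy t x
  | EAdd a b => comp_expr a t ;; comp_expr b t.+1 ;; CAdd t t t.+1
  | ESub a b => comp_expr a t ;; comp_expr b t.+1 ;; CSub t t t.+1
  | EGet a e => comp_expr e t ;; addr t a ;; CLoad t t
  | ESum i b e =>
      comp_expr b t.+1 ;; CConst t 0 ;; CConst t.+2 0 ;; copy t.+3 i ;;
      CWhile t.+2 t.+1
        (copy i t.+2 ;; comp_expr e t.+4 ;; CAdd t t t.+4 ;;
         CConst t.+4 1 ;; CAdd t.+2 t.+2 t.+4) ;;
      copy i t.+3
  end.

(** The true loop counter is the temporary [t.+1], and the variable [i] is only a copy, so a body
    may overwrite [i]. *)
Fixpoint compile (c : hcmd) (t : nat) : cmd :=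
  match c with
  | HSet x e => comp_expr e t ;; copy x t
  | HPut a i e => comp_expr i t ;; addr t a ;; comp_expr e t.+1 ;; CStore t t.+1
  | HSeq c1 c2 => compile c1 t ;; compile c2 t
  | HIf a b c1 c2 =>
      comp_expr a t ;; comp_expr b t.+1 ;; CIf t t.+1 (compile c1 t) (compile c2 t)
  | HFor i b c =>
      comp_expr b t ;; CConst t.+1 0 ;;
      CWhile t.+1 t
        (copy i t.+1 ;; compile c t.+2 ;; CConst t.+2 1 ;; CAdd t.+1 t.+1 t.+2)
  end.

Fixpoint efits (e : expr) (t : nat) : bool :=
  match e with
  | EC _ => t < 64
  | EV x => (x < 32) && (t < 64)
  | EAdd a b | ESub a b => efits a t && efits b t.+1
  | EGet a e => [&& a < 16, efits e t & t.+1 < 64]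
  | ESum i b e => [&& i < 32, efits b t.+1, efits e t.+4 & t.+4 < 64]
  end.

Fixpoint fits (c : hcmd) (t : nat) : bool :=
  match c with
  | HSet x e => (x < 32) && efits e t
  | HPut a i e => [&& a < 16, efits i t & efits e t.+1]
  | HSeq c1 c2 => fits c1 t && fits c2 t
  | HIf a b c1 c2 => [&& efits a t, efits b t.+1, fits c1 t & fits c2 t]
  | HFor i b c => [&& i < 32, efits b t, fits c t.+2 & t.+2 < 64]
  end.

Ltac urun := rewrite /copy /addr;
  repeat first
  [ apply: runs_seq | apply: runs_const | apply: runs_add | apply: runs_sub
  | apply: runs_load | apply: runs_store | apply: runs_skip ].

Lemma upd_eq M a v : upd M a v a = v.
Proof. by rewrite /upd eqxx. Qed.

Lemma upd_neq M a v i : i != a -> upd M a v i = M i.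
Proof. by rewrite /upd => /negbTE ->. Qed.

Ltac mem := repeat first [rewrite upd_eq | rewrite upd_neq; [|by lia] ].

(* Evaluating an expression clobbers only the temporaries from [t] on. *)
Definition same_below (t : nat) (M M' : memory) : Prop :=
  forall x, x < t \/ 64 <= x -> M' x = M x.

Lemma rep_same base s t M M' : 32 < t -> 64 <= base ->
  stored base s M -> same_below t M M' -> stored base s M'.
Proof.
move=> t32 b64 [rb rr ra] same; split.
- by rewrite same //; left.
- by move=> x x32; rewrite same ?rr //; left; lia.
- by move=> a i a16; rewrite same ?ra //; right; lia.
Qed.

Lemma same_refl t M : same_below t M M.
Proof. by []. Qed.
#[local] Hint Resolve same_refl : core.

Lemma same_trans t t' M M1 M2 : t <= t' ->
  same_below t M M1 -> same_below t' M1 M2 -> same_below t M M2.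
Proof. by move=> le s1 s2 x hx; rewrite s2 ?s1 //; lia. Qed.

Lemma same_upd t M M' x v : t <= x < 64 ->
  same_below t M M' -> same_below t M (upd M' x v).
Proof. by move=> hx same y hy; rewrite upd_neq ?same //; lia. Qed.

Lemma rep_setr base s M x v : 64 <= base -> x < 32 ->
  stored base s M -> stored base (setr s x v) (upd M x v).
Proof.
move=> b64 x32 [rb rr ra]; split => [|y y32|a i a16] /=.
- by rewrite upd_neq ?rb //; lia.
- by rewrite /upd; case: eqP => // _; exact: rr.
- by rewrite upd_neq ?ra //; lia.
Qed.

Lemma rep_seta base s M a i v : 64 <= base -> a < 16 ->
  stored base s M -> stored base (seta s a i v) (upd M (base + 16 * i + a) v).
Proof.
move=> b64 a16 [rb rr ra]; split => [|y y32|b j b16] /=.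
- by rewrite upd_neq ?rb //; lia.
- by rewrite upd_neq ?rr //; lia.
- rewrite /upd; have -> : (base + 16 * j + b == base + 16 * i + a)
      = (b == a) && (j == i) by lia.
  by case: ifP => // _; exact: ra.
Qed.

Lemma efits_lt e t : efits e t -> t < 64.
Proof.
elim: e t => //= [x|a IHa b _|a IHa b _|a e _|i b _ e _] t; try lia.
- by case/andP => /IHa.
- by case/andP => /IHa.
Qed.

Lemma runs_addr base s M t a (Q : memory -> Prop) :
  64 <= base -> 32 < t -> t.+1 < 64 -> stored base s M ->
  (forall M', M' t = base + 16 * M t + a ->
     (forall x, x != t -> x != t.+1 -> M' x = M x) -> Q M') ->
  runs (addr t a) M 7 Q.
Proof.
move=> b64 t32 t64 [rb _ _] h.
apply: runs_weaken (_ : _ <= 7) _; [urun|by []|move=> M'; exact: id].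
apply: h => //; first by mem; lia.
by move=> x x1 x2; mem.
Qed.

Definition expr_ok base e := forall s M t, 32 < t -> efits e t ->
  stored base s M ->
  runs (comp_expr e t) M (ecost e s)
    (fun M' => M' t = eval e s /\ same_below t M M').

Lemma runs_pair base a b s M t c T (Q : memory -> Prop) : 64 <= base ->
  expr_ok base a -> expr_ok base b -> 32 < t -> efits a t -> efits b t.+1 ->
  stored base s M ->
  (forall M', M' t = eval a s -> M' t.+1 = eval b s -> same_below t M M' ->
     runs c M' T Q) ->
  runs (comp_expr a t ;; comp_expr b t.+1 ;; c) M (ecost a s + ecost b s + T) Q.
Proof.
move=> b64 oka okb t32 fa fb r h; rewrite -addnA.
apply: runs_seq; apply: runs_weaken (oka _ _ _ t32 fa r) (leqnn _) _.
move=> M1 [e1 s1]; apply: runs_seq.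
have t33 : 32 < t.+1 by lia.
apply: runs_weaken (okb s M1 t.+1 t33 fb (rep_same _ _ r s1)) (leqnn _) _ => //.
move=> M2 [e2 s2]; apply: h => //; first by rewrite s2 //; lia.
by apply: same_trans s1 s2; lia.
Qed.

Lemma comp_expr_ok base e : 64 <= base -> expr_ok base e.
Proof.
move=> b64; elim: e => [v|x|a IHa b IHb|a IHa b IHb|a e IH|i b IHb e IHe]
  s M t t32 /= fit r.
- by urun; rewrite upd_eq; split=> //; apply: same_upd; rewrite ?leqnn.
- apply: runs_weaken (_ : _ <= 1 + 1) _; [urun|by []|move=> M' h; exact: h].
  mem; case: r => _ -> //; last by lia.
  by split=> //; do 2 (apply: same_upd; [lia|]).
- case/andP: fit => fa fb; apply: (runs_pair b64 IHa IHb) r _ => // M' e1 e2 s1.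
  have t64 := efits_lt fa.
  by urun; mem; rewrite e1 e2; split=> //; apply: same_upd => //; rewrite leqnn.
- case/andP: fit => fa fb; apply: (runs_pair b64 IHa IHb) r _ => // M' e1 e2 s1.
  have t64 := efits_lt fa.
  by urun; mem; rewrite e1 e2; split=> //; apply: same_upd => //; rewrite leqnn.
- case/and3P: fit => a16 fe t64.
  apply: runs_seq; apply: runs_weaken (IH _ _ _ t32 fe r) (leqnn _) _.
  move=> M1 [e1 s1]; have r1 := rep_same t32 b64 r s1.
  apply: (@runs_seq _ _ _ 7 1); apply: (runs_addr b64 t32 t64 r1).
  move=> M2 e2 s2; urun; mem; rewrite e2 s2 ?e1; try lia.
  case: r1 => _ _ -> //; split=> //; apply: same_upd; first by lia.
  by move=> x hx; rewrite s2 ?s1 //; lia.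
- case/and4P: fit => i32 fb fe t64.
  have t33 : 32 < t.+1 by lia.
  rewrite (_ : _ + _ = ecost b s + (1 + (1 + ((1 + 1) + (
    (\sum_(j < eval b s) (ecost e (setr s i j) + 5 + 2) + 2) + (1 + 1)))))); last first.
    have -> : \sum_(j < eval b s) (ecost e (setr s i j) + 5 + 2)
        = \sum_(j < eval b s) (ecost e (setr s i j) + 7).
      by apply: eq_bigr => j _; lia.
    by move: (\sum_(j < _) _) => S; lia.
  apply: runs_seq; apply: runs_weaken (IHb _ _ _ t33 fb r) (leqnn _) _ => M1 [e1 s1].
  urun.
  set M2 := upd _ _ _.
  pose J j M' := [/\ M' t = \sum_(l < j) eval e (setr s i l), M' t.+1 = eval b s,
    M' t.+2 = j, M' t.+3 = s.1 i & forall x, x <> i -> x < t \/ 64 <= x -> M' x = M x].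
  have Mi : M i = s.1 i by case: r => _ ->.
  apply: (runs_while (J := J) (B := eval b s)
    (f := fun j => ecost e (setr s i j) + 5)).
  + rewrite /J big_ord0 /M2; split; try by mem.
      by mem; rewrite s1 ?Mi //; lia.
    by move=> x xi hx; mem; rewrite s1; lia.
  + move=> j M' jB [J1 J2 J3 J4 J5]; split; first by rewrite J2 J3.
    have -> : ecost e (setr s i j) + 5 = (1 + 1) + (ecost e (setr s i j) + (1 + (1 + 1))).
      by lia.
    urun.
    set M3 := upd _ _ _.
    have r3 : stored base (setr s i j) M3.
      have M3i : M3 = upd (upd M' i 0) i (0 + M' t.+2) by rewrite /M3; mem.
      apply: (@rep_same _ _ t (upd M i j)) => //; first exact: rep_setr.
      move=> x hx; rewrite M3i /upd; case: eqP => [_|xi]; first by rewrite J3.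
      exact: J5.
    have t34 : 32 < t.+4 by lia.
    apply: runs_weaken (IHe _ _ _ t34 fe r3) (leqnn _) _ => M4 [e4 s4].
    have E x : x <> i -> x < t.+4 \/ 64 <= x -> M4 x = M' x.
      by move=> xi hx; rewrite s4 // /M3; mem.
    urun; split; mem; rewrite ?e4 ?E ?J1 ?J2 ?J3 ?J4 ?big_ord_recr //=; try lia.
    by move=> x xi hx; mem; rewrite E ?J5 //; lia.
  + move=> M' [J1 J2 J3 J4 J5]; split; first by rewrite J2 J3.
    urun; mem; split=> // x hx; rewrite /upd; case: eqP => [->|xi]; last by exact: J5.
    by rewrite J4 Mi.
Qed.

(** The cells between 32 and [t] are preserved because enclosing loops keep their bounds and
    counters there. *)
Lemma comp_ok base c s M t : 64 <= base -> 32 < t -> fits c t ->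
  stored base s M ->
  runs (compile c t) M (hrun c s).2 (fun M' => stored base (hrun c s).1 M' /\
    forall x, 32 < x < t -> M' x = M x).
Proof.
move=> b64; elim: c s M t => [x e|a i e|c1 IH1 c2 IH2|a b c1 IH1 c2 IH2|i b c IH]
  s M t t32 /= fit r.
- case/andP: fit => x32 fe; apply: runs_seq.
  apply: runs_weaken (comp_expr_ok b64 t32 fe r) (leqnn _) _ => M1 [e1 s1].
  apply: runs_weaken (_ : _ <= 1 + 1) _; [urun|by []|move=> M' h; exact: h].
  split; last by move=> y hy; mem; rewrite s1 //; lia.
  have r1 := rep_setr (eval e s) b64 x32 (rep_same t32 b64 r s1).
  case: r1 => rb rr ra; split.
  + by rewrite -rb; mem.
  + by move=> y y32; rewrite -rr //; have [->|yx] := eqVneq y x; mem; rewrite ?e1.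
  + by move=> b j b16; rewrite -ra //; mem.
- case/and3P: fit => a16 fi fe; have t64 := efits_lt fe.
  have -> : ecost i s + ecost e s + 8 = ecost i s + (7 + (ecost e s + 1)) by lia.
  apply: runs_seq; apply: runs_weaken (comp_expr_ok b64 t32 fi r) (leqnn _) _.
  move=> M1 [e1 s1]; apply: runs_seq.
  apply: (runs_addr b64 t32 t64 (rep_same t32 b64 r s1)) => M2 e2 s2.
  have s2' : same_below t M M2 by move=> x hx; rewrite s2 ?s1 //; lia.
  have t33 : 32 < t.+1 by lia.
  apply: runs_seq; apply: runs_weaken
    (comp_expr_ok b64 t33 fe (rep_same t32 b64 r s2')) (leqnn _) _ => M3 [e3 s3].
  urun; rewrite e3 s3 ?e2 ?e1; last by lia.
  split; last by move=> x hx; mem; rewrite s3 ?s2' //; lia.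
  apply: rep_seta => //; apply: rep_same t32 b64 r _; apply: same_trans s2' s3; lia.
- case/andP: fit => f1 f2; apply: runs_seq.
  apply: runs_weaken (IH1 _ _ _ t32 f1 r) (leqnn _) _ => M1 [r1 s1].
  apply: runs_weaken (IH2 _ _ _ t32 f2 r1) (leqnn _) _ => M2 [r2 s2].
  by split=> // x hx; rewrite s2 ?s1.
- case/and4P: fit => fa fb f1 f2.
  have ok e : expr_ok base e by exact: comp_expr_ok.
  rewrite -addnA; apply: (runs_pair b64 (ok a) (ok b)) (r) _ => // M' e1 e2 s1'.
  have r' := rep_same t32 b64 r s1'.
  rewrite addn2; apply: runs_if => [|/leq_gtF]; rewrite e1 e2 => ->.
  + apply: runs_weaken (IH1 _ _ _ t32 f1 r') (leqnn _) _ => M1 [r1 h1].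
    by split=> // x hx; rewrite h1 // s1' //; lia.
  + apply: runs_weaken (IH2 _ _ _ t32 f2 r') (leqnn _) _ => M1 [r1 h1].
    by split=> // x hx; rewrite h1 // s1' //; lia.
- case/and4P: fit => i32 fb fc t64.
  (* [st j] is the state and the accumulated cost after [j] rounds. *)
  set F := fun r j => _; pose st j := foldl F (s, 0) (iota 0 j).
  have stS j : st j.+1 = F (st j) j by rewrite /st -[j.+1]addn1 iotaD foldl_cat.
  pose f j := (hrun c (setr (st j).1 i j)).2 + 4.
  have cost B : (st B).2 = \sum_(j < B) (f j + 2).
    elim: B => [|B IHB]; first by rewrite big_ord0.
    by rewrite stS big_ord_recr /= -IHB /f; lia.
  rewrite -/(st _) cost.
  have -> : ecost b s + \sum_(j < eval b s) (f j + 2) + 3 =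
    ecost b s + (1 + (\sum_(j < eval b s) (f j + 2) + 2)).
    by move: (\sum_(j < _) _) => S; lia.
  apply: runs_seq; apply: runs_weaken (comp_expr_ok b64 t32 fb r) (leqnn _) _.
  move=> M1 [e1 s1]; urun.
  pose J j M' := [/\ stored base (st j).1 M', M' t = eval b s, M' t.+1 = j &
     forall x, 32 < x < t -> M' x = M x].
  apply: (runs_while (J := J)).
  + split; mem => //.
    * apply: (rep_same t32 b64 r); apply: same_upd => //; lia.
    * by move=> x hx; mem; rewrite s1 //; lia.
  + move=> j M' jB [r' J2 J3 J4]; split; first by rewrite J2 J3.
    have -> : f j = (1 + 1) + ((hrun c (setr (st j).1 i j)).2 + (1 + 1)) by rewrite /f; lia.
    urun; set M2 := upd _ _ _.
    have r2 : stored base (setr (st j).1 i j) M2.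
      apply: (@rep_same _ _ t (upd M' i j)) => //; first exact: rep_setr.
      move=> x _; rewrite /M2; have [->|xi] := eqVneq x i; mem; rewrite ?J3 //.
    have t34 : 32 < t.+2 by lia.
    apply: runs_weaken (IH _ _ _ t34 fc r2) (leqnn _) _ => M3 [r3 s3].
    urun; split; mem.
    * rewrite stS /=; apply: (rep_same t32 b64 r3).
      by apply: same_upd; [lia|apply: same_upd; [lia|]].
    * by rewrite s3 /M2; [mem|lia].
    * by rewrite s3 /M2; [mem; rewrite J3 addn1|lia].
    * by move=> x hx; mem; rewrite s3 /M2; [mem; exact: J4|lia].
  + by move=> M' [r' J2 J3 J4]; rewrite J2 J3.
Qed.

(** * Extending tuples of incidences *)

Implicit Types (t g : nat -> bool) (mm : nat -> nat -> bool).
Implicit Types vs es : nat -> nat.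

Definition cnt (N : nat) mm t e : nat :=
  \sum_(v < N) (t v && mm e v).
Definition nverts N t : nat := \sum_(v < N) t v.
Definition hits N m mm t : Prop := forall e, e < m -> 0 < cnt N mm t e.
(** An edge that contains [v] and at most one element of the set is a private edge of [v]. *)
Definition critical N m mm t : Prop :=
  forall v, v < N -> t v -> exists2 e, e < m & mm e v && (cnt N mm t e <= 1).

Definition sel q vs v : bool := [exists i : 'I_q, vs i == v].
Definition cover mm q es v : bool :=
  [exists i : 'I_q, mm (es i) v].
Definition free N mm q vs e : bool := ~~ [exists v : 'I_N, sel q vs v && mm e v].
Definition nfree N m mm q vs : nat := \sum_(e < m) free N mm q vs e.
Definition fdeg N m mm q vs v : nat := \sum_(e < m) (mm e v && free N mm q vs e).
(** A vertex misses some free edge iff its free degree is below the number of free edges. The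
    summand [2 - k] vanishes for k >= 2 and makes the test always true for k < 2, where the
    candidate is to be everything. *)
Definition extend N m mm k vs es v : bool :=
  sel (k - 2) vs v || ~~ cover mm (k - 2) es v &&
    (fdeg N m mm (k - 2) vs v < nfree N m mm (k - 2) vs + (2 - k)).

Definition removable N m mm t v : bool :=
  t v && [forall e : 'I_m, mm e v ==> (1 < cnt N mm t e)].
Fixpoint greedy N m mm t j : nat -> bool :=
  if j is j'.+1 then
    let g := greedy N m mm t j' in fun v => g v && ~~ ((v == j') && removable N m mm g j')
  else t.

Lemma cnt_gt0 N mm t e :
  0 < cnt N mm t e <-> exists v, [/\ v < N, t v & mm e v].
Proof.
rewrite /cnt lt0n sum_nat_eq0 negb_forall; split.
- move=> /existsP [v] /=; rewrite eqb0 negbK => /andP [tv mv].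
  by exists v; split=> //; exact: ltn_ord.
- move=> [v [vN tv mv]]; apply/existsP; exists (Ordinal vN).
  by rewrite /= tv mv.
Qed.

Lemma cnt_sub N mm t t' e : (forall v, v < N -> t v -> t' v) ->
  cnt N mm t e <= cnt N mm t' e.
Proof.
move=> sub; apply: leq_sum => v _.
by case tv: (t v) => //=; rewrite (sub v) //; exact: ltn_ord.
Qed.

Lemma cnt_le1 N mm t e v w : cnt N mm t e <= 1 -> v < N -> w < N ->
  t v -> mm e v -> t w -> mm e w -> v = w.
Proof.
move=> le vN wN tv mv tw mw; apply/eqP/negP => /negP vw; move: le.
rewrite /cnt (bigD1 (Ordinal vN)) //= tv mv (bigD1 (Ordinal wN)) /= ?tw ?mw //.
by rewrite -val_eqE /= eq_sym.
Qed.

Lemma nvertsE N t : nverts N t = size (filter t (iota 0 N)).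
Proof.
rewrite /nverts -(big_mkord xpredT (fun v => t v : nat)) size_filter -sum1_count.
rewrite [RHS]big_mkcond /index_iota subn0; apply: eq_bigr => i _.
by case: (t i).
Qed.

Lemma greedy_sub N m mm t j j' v : j <= j' ->
  greedy N m mm t j' v -> greedy N m mm t j v.
Proof.
elim: j' => [|j' IH]; first by rewrite leqn0 => /eqP ->.
rewrite leq_eqVlt => /orP [/eqP -> //|lt] /= /andP [g _]; exact: IH.
Qed.

(** An edge through the removed vertex contained at least two elements of the set, so it keeps
    one. *)
Lemma greedy_hits N m mm t j : j <= N -> hits N m mm t -> hits N m mm (greedy N m mm t j).
Proof.
move=> jN ht; elim: j jN => [//|j IH] jN e em /=.
have := IH (ltnW jN) e em; set g := greedy _ _ _ _ _ => ge.
have [/andP [gj /forallP /(_ (Ordinal em)) /= rj]|nr] := boolP (removable N m mm g j); last first.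
  apply: leq_trans ge _; apply: cnt_sub => v _ ->; by rewrite andbF.
have [mj|nm] := boolP (mm e j).
- rewrite mj /= in rj.
  have : cnt N mm g e <= (cnt N mm (fun v => g v && ~~ ((v == j) && true)) e).+1.
    rewrite /cnt (bigD1 (Ordinal jN)) //= [X in _ <= X.+1](bigD1 (Ordinal jN)) //= eqxx andbF /=.
    rewrite add0n -add1n leq_add ?leq_b1 //; apply: leq_sum => i ij.
    by rewrite andbT (_ : (i == j :> nat) = false) ?andbT //; apply/negbTE.
  by lia.
- apply: leq_trans ge _; apply: leq_sum => v _.
  by have [->|] := eqVneq (v : nat) j; rewrite ?(negbTE nm) ?andbF ?andbT.
Qed.

(** A surviving vertex [v] was not removable at its turn, so some edge was private to it then; later
    removals only shrink the set and keep that edge private. *)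
Lemma greedy_critical N m mm t : critical N m mm (greedy N m mm t N).
Proof.
move=> v vN gv; have := greedy_sub vN gv => /=; rewrite eqxx /= => /andP [gv'].
rewrite negb_and gv' /= negb_forall => /existsP [e].
rewrite negb_imply -leqNgt => /andP [mv le]; exists e; first exact: ltn_ord.
rewrite mv; apply: leq_trans le; apply: cnt_sub => w _; exact: greedy_sub (ltnW vN).
Qed.

Lemma fdeg_lt N m mm q vs v : fdeg N m mm q vs v < nfree N m mm q vs <->
  exists e, [/\ e < m, free N mm q vs e & ~~ mm e v].
Proof.
rewrite /fdeg /nfree; split => [lt|[e [em fe ne]]].
- have /existsP [e /andP [fe ne]] : [exists e : 'I_m, free N mm q vs e && ~~ mm e v].
    apply: contraTT lt; rewrite negb_exists -leqNgt => /forallP h.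
    apply: leq_sum => e _; have := h e.
    by case: free => //=; rewrite negbK => ->.
  by exists e; split=> //; exact: ltn_ord.
- rewrite (bigD1 (Ordinal em)) //= [X in _ < X](bigD1 (Ordinal em)) //= fe (negbTE ne) /=.
  rewrite add0n add1n ltnS; apply: leq_sum => i _.
  by case: (mm i v).
Qed.

Lemma freeE N mm q vs e : free N mm q vs e <->
  forall i, i < q -> vs i < N -> ~~ mm e (vs i).
Proof.
rewrite /free negb_exists; split => [/forallP h i iq vN|h].
- have := h (Ordinal vN); rewrite negb_and /= => /orP [|//].
  by rewrite negb_exists => /forallP /(_ (Ordinal iq)); rewrite eqxx.
- apply/forallP => v; rewrite negb_and -implybE; apply/implyP => /existsP [i /eqP e1].
  by rewrite -e1; apply: h => //; rewrite e1.
Qed.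

(** Completeness: some tuple of incidences leads to a set of size at least k. The tuple consists of
    the first k - 2 vertices of [t] with their private edges; the two vertices that remain guarantee
    free edges. *)
Lemma extend_complete N m mm k t : hits N m mm t -> critical N m mm t ->
  k <= nverts N t ->
  exists vs es, [/\ forall i, i < k - 2 -> [/\ vs i < N, es i < m & mm (es i) (vs i)],
    hits N m mm (extend N m mm k vs es) &
    k <= nverts N (greedy N m mm (extend N m mm k vs es) N)].
Proof.
move=> ht ct kt; have [k2|k2] := ltnP k 2.
  have q0 : k - 2 = 0 by lia.
  exists (fun=> 0), (fun=> 0).
  have ext v : extend N m mm k (fun=> 0) (fun=> 0) v.
    rewrite /extend q0; apply/orP; right; apply/andP; split.
      by rewrite negb_exists; apply/forallP => [[]].
    apply: leq_ltn_trans (_ : nfree N m mm 0 (fun=> 0) < _); last by lia.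
    by apply: leq_sum => e _; case: (mm e v).
  have hx : hits N m mm (extend N m mm k (fun=> 0) (fun=> 0)).
    move=> e em; apply: leq_trans (ht e em) _; apply: cnt_sub => v _ _; exact: ext.
  rewrite q0; split=> //.
  (* For k = 1 a vertex of [t] supplies an edge, and a hitting set of that edge is nonempty. *)
  case: k k2 kt {q0 ext} hx => [|[|//]] _ // kt hx.
  have : exists v, v < N /\ t v.
    move: kt; rewrite nvertsE size_filter -has_count => /hasP [v].
    by rewrite mem_iota => vN tv; exists v.
  move=> [v [vN /(ct v vN) [e em _]]].
  have /cnt_gt0 [w [wN gw _]] := greedy_hits (leqnn N) hx em.
  by rewrite nvertsE size_filter -has_count; apply/hasP; exists w; rewrite ?mem_iota.
pose s := filter t (iota 0 N).
have [q kq] : exists q, k = q.+2 by exists (k - 2); lia.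
have ks : q.+2 <= size s by rewrite -nvertsE -kq.
have us : uniq s by rewrite filter_uniq // iota_uniq.
pose vs i := nth 0 s i.
pose pe v := find (fun e => mm e v && (cnt N mm t e <= 1)) (iota 0 m).
have vP i : i < q.+2 -> vs i < N /\ t (vs i).
  move=> iq; have : vs i \in s by apply: mem_nth; apply: leq_trans ks.
  by rewrite mem_filter mem_iota => /andP [].
have peP v : v < N -> t v -> [/\ pe v < m, mm (pe v) v & cnt N mm t (pe v) <= 1].
  move=> vN tv; have h : has (fun e => mm e v && (cnt N mm t e <= 1)) (iota 0 m).
    have [e em he] := ct v vN tv.
    by apply/hasP; exists e => //; rewrite mem_iota.
  have := nth_find 0 h; have := h; rewrite has_find size_iota => lt.
  by rewrite nth_iota // add0n => /andP [].
have peU v w : v < N -> t v -> w < N -> t w -> mm (pe v) w -> w = v.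
  move=> vN tv wN tw mw; have [_ mv c1] := peP v vN tv.
  exact: cnt_le1 c1 wN vN tw mw tv mv.
have vinj i j : i < q.+2 -> j < q.+2 -> vs i = vs j -> i = j.
  by move=> iq jq /eqP; rewrite nth_uniq //; [move/eqP|exact: leq_trans ks|exact: leq_trans ks].
pose es i := pe (vs i).
have kq2 : k - 2 = q by lia.
exists vs, es; rewrite kq2.
pose t0 := extend N m mm k vs es.
have t0E v : t0 v = sel q vs v || ~~ cover mm q es v &&
    (fdeg N m mm q vs v < nfree N m mm q vs).
  by rewrite /t0 /extend kq2 (_ : 2 - k = 0) ?addn0 //; move: k2; clear; lia.
have selP v : reflect (exists2 i, i < q & vs i = v) (sel q vs v).
  apply: (iffP existsP) => [[i /eqP e]|[i iq e]]; first by exists i; rewrite ?ltn_ord.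
  by exists (Ordinal iq); rewrite /= e.
have coverP v : reflect (exists2 i, i < q & mm (es i) v) (cover mm q es v).
  apply: (iffP existsP) => [[i e]|[i iq e]]; first by exists i; rewrite ?ltn_ord.
  by exists (Ordinal iq).
have lq i : i < q -> i < q.+2 by lia.
(* The private edges of the two remaining vertices avoid all chosen ones. *)
have freeq j : q <= j < q.+2 -> free N mm q vs (pe (vs j)).
  move=> /andP [qj jq]; apply/freeE => // i iq vN; apply/negP => mi.
  have [v1 t1] := vP i (lq _ iq); have [v2 t2] := vP j jq.
  have e := vinj _ _ (lq _ iq) jq (peU _ _ v2 t2 v1 t1 mi).
  by move: qj; rewrite -e leqNgt iq.
have sub v : v < N -> t v -> t0 v.
  move=> vN tv; rewrite t0E; case: selP => //= nsel.
  apply/andP; split.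
    apply/coverP => -[i iq mi]; apply: nsel; exists i => //.
    by have [v1 t1] := vP i (lq _ iq); rewrite (peU _ _ v1 t1 vN tv mi).
  (* Of the two remaining vertices at least one differs from [v], and its private edge is a free
     edge that [v] misses. *)
  have [j jq vj] : exists2 j, q <= j < q.+2 & vs j != v.
    have [e|ne] := eqVneq (vs q) v; last by exists q => //; lia.
    exists q.+1; first by lia.
    by rewrite -e; apply/eqP => /(vinj _ _ (ltnSn _) (ltnW (ltnSn _))); lia.
  have [v1 t1] := vP j (proj2 (andP jq)).
  apply/fdeg_lt; exists (pe (vs j)); have [p1 p2 p3] := peP _ v1 t1.
  split; [by []|exact: freeq|apply/negP => mj].
  by rewrite (peU _ _ v1 t1 vN tv mj) eqxx in vj.
have ht0 : hits N m mm t0.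
  by move=> e em; apply: leq_trans (ht e em) _; exact: cnt_sub.
pose g := greedy N m mm t0 N.
have hg : hits N m mm g by exact: greedy_hits.
have g0 v : g v -> t0 v by exact: (@greedy_sub _ _ _ _ 0 N).
(* The private edge of [vs i] must still be hit. Candidates outside the tuple avoid it by the
   [cover] condition, and so do the other chosen vertices. *)
have gs i : i < q -> g (vs i).
  move=> iq; have [v1 t1] := vP i (lq _ iq); have [p1 p2 p3] := peP _ v1 t1.
  have /cnt_gt0 [u [uN gu mu]] := hg _ p1.
  have := g0 _ gu; rewrite t0E => /orP [/selP [j jq ej]|/andP [/coverP []]]; last by exists i.
  have [v2 t2] := vP j (lq _ jq).
  by rewrite -ej in mu gu; rewrite -(peU _ _ v1 t1 v2 t2 mu).
have hitfree e : e < m -> free N mm q vs e ->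
    exists u, [/\ u < N, g u, mm e u & ~~ sel q vs u].
  move=> em fe; have /cnt_gt0 [u [uN gu mu]] := hg _ em.
  exists u; split=> //; apply/selP => -[i iq ei].
  by move/freeE: fe => /(_ i iq); rewrite ei uN mu => /(_ isT).
split=> //.
  by move=> i iq; have [v1 t1] := vP i (lq _ iq); have [p1 p2 p3] := peP _ v1 t1.
have [v1 t1] := vP q (ltnW (ltnSn _)); have [p1 p2 p3] := peP _ v1 t1.
(* [u1] hits a free edge, so it is not chosen and hence misses another free edge [e]; whatever hits
   [e] is a second unchosen vertex [u2]. *)
have [|u1 [u1N gu1 mu1 su1]] := hitfree _ p1; first by apply: freeq; lia.
have := g0 _ gu1; rewrite t0E (negbTE su1) /= => /andP [_ /fdeg_lt [e [em fe ne]]].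
have [u2 [u2N gu2 mu2 su2]] := hitfree _ em fe.
rewrite -/t0 -/g nvertsE; have -> : k = size [:: u1, u2 & map vs (iota 0 q)] by rewrite /= size_map size_iota; lia.
apply: uniq_leq_size => /=.
  rewrite inE negb_or map_inj_in_uniq ?iota_uniq; last first.
    by move=> i j; rewrite !mem_iota => iq jq; apply: vinj; lia.
  rewrite andbT -andbA; apply/and3P; split.
  - by apply: contra ne => /eqP ->.
  - apply: contra su1 => /mapP [i]; rewrite mem_iota => iq ->; apply/selP; by exists i.
  - apply: contra su2 => /mapP [i]; rewrite mem_iota => iq ->; apply/selP; by exists i.
move=> x; rewrite mem_filter mem_iota !inE => /or3P [/eqP ->|/eqP ->|].
- by rewrite gu1.
- by rewrite gu2.
- move/mapP => [i]; rewrite mem_iota => iq ->; rewrite gs //=.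
  by have [] := vP i (lq _ iq).
Qed.

(** Hit counts are updated rather than recomputed, which keeps a greedy step at O(m). *)
Lemma cnt_greedyS N m mm t j e : j < N ->
  cnt N mm (greedy N m mm t j.+1) e =
  cnt N mm (greedy N m mm t j) e - (mm e j && removable N m mm (greedy N m mm t j) j).
Proof.
move=> jN /=; set g := greedy _ _ _ _ _; set r := removable _ _ _ _ _.
have rg : r -> g j by rewrite /r /removable => /andP [].
rewrite /cnt (bigD1 (Ordinal jN)) //= [in RHS](bigD1 (Ordinal jN)) //= eqxx.
have -> : \sum_(i < N | i != Ordinal jN) ((g i && ~~ ((i == j :> nat) && r)) && mm e i)
    = \sum_(i < N | i != Ordinal jN) (g i && mm e i).
  by apply: eq_bigr => i ij; rewrite (_ : (i == j :> nat) = false) ?andbT //; apply/negbTE.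
by case: r rg => [->|_]; case: (mm e j); rewrite ?andbT ?andbF ?subn0 // add1n subn1.
Qed.

(** * Program logic *)

Arguments upd M a v i /.

Fixpoint written (c : hcmd) : seq nat :=
  match c with
  | HSet x _ => [:: x]
  | HPut _ _ _ => [::]
  | HSeq c1 c2 | HIf _ _ c1 c2 => written c1 ++ written c2
  | HFor i _ c => i :: written c
  end.
Fixpoint awritten (c : hcmd) : seq nat :=
  match c with
  | HSet _ _ => [::]
  | HPut a _ _ => [:: a]
  | HSeq c1 c2 | HIf _ _ c1 c2 => awritten c1 ++ awritten c2
  | HFor _ _ c => awritten c
  end.

Definition agree (W A : seq nat) (s s' : state) : Prop :=
  (forall x, x \notin W -> s'.1 x = s.1 x) /\
  (forall a i, a \notin A -> s'.2 a i = s.2 a i).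

Lemma agree_refl W A s : agree W A s s.
Proof. by []. Qed.

Lemma agree_trans W1 A1 W2 A2 s1 s2 s3 :
  agree W1 A1 s1 s2 -> agree W2 A2 s2 s3 -> agree (W1 ++ W2) (A1 ++ A2) s1 s3.
Proof.
move=> [r1 a1] [r2 a2]; split.
- by move=> x; rewrite mem_cat negb_or => /andP [h1 h2]; rewrite r2 ?r1.
- by move=> a i; rewrite mem_cat negb_or => /andP [h1 h2]; rewrite a2 ?a1.
Qed.

Lemma agree_sub W A W' A' s s' : {subset W <= W'} -> {subset A <= A'} ->
  agree W A s s' -> agree W' A' s s'.
Proof.
move=> sW sA [r a]; split => [x xW|b i bA]; first by rewrite r //; apply: contra xW => /sW.
by rewrite a //; apply: contra bA => /sA.
Qed.

Lemma agree_setr W A s s' x v : agree W A s s' -> agree (x :: W) A s (setr s' x v).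
Proof.
move=> [r a]; split=> // y; rewrite inE negb_or => /andP [yx yW].
by rewrite /= /upd (negbTE yx) r.
Qed.

Lemma agree_hrun c s : agree (written c) (awritten c) s (hrun c s).1.
Proof.
elim: c s => [x e|a i e|c1 IH1 c2 IH2|a b c1 IH1 c2 IH2|i b c IH] s /=.
- exact: agree_setr.
- split=> // b j; rewrite inE => ba /=; by rewrite (negbTE ba).
- exact: agree_trans (IH1 _) (IH2 _).
- by case: ifP => _; [apply: agree_sub (IH1 s)|apply: agree_sub (IH2 s)] => x xi; rewrite mem_cat xi ?orbT.
- elim: (eval b s) => [//|B]; rewrite -[B.+1]addn1 iotaD foldl_cat /=.
  set r := foldl _ _ _ => h.
  apply: agree_sub (agree_trans h (agree_trans (agree_setr i B (agree_refl [::] [::] _)) (IH _))).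
  + by move=> x; rewrite !(inE, mem_cat); case: (x == i); case: (x \in _).
  + by move=> x; rewrite mem_cat => /orP [].
Qed.

(** The postcondition may assume the frame property [agree], which holds for every command by
    [agree_hrun]; invariants thus need not mention what is left untouched. *)
Definition tri (c : hcmd) (s : state) (T : nat) (Q : state -> Prop) : Prop :=
  (hrun c s).2 <= T /\ (agree (written c) (awritten c) s (hrun c s).1 -> Q (hrun c s).1).

Lemma tri_weaken c s T T' (Q Q' : state -> Prop) : tri c s T Q -> T <= T' ->
  (forall s', agree (written c) (awritten c) s s' -> Q s' -> Q' s') -> tri c s T' Q'.
Proof.
move=> [le q] le' imp; split; first exact: leq_trans le le'.
by move=> ag; apply: imp => //; exact: q.
Qed.

Lemma tri_set x e s T (Q : state -> Prop) : ecost e s + 2 <= T ->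
  Q (setr s x (eval e s)) -> tri (HSet x e) s T Q.
Proof. by []. Qed.

Lemma tri_put a i e s T (Q : state -> Prop) : ecost i s + ecost e s + 8 <= T ->
  Q (seta s a (eval i s) (eval e s)) -> tri (HPut a i e) s T Q.
Proof. by []. Qed.

Lemma tri_seq c1 c2 s T1 T T2 Q : T1 + T2 <= T ->
  tri c1 s T1 (fun s1 => tri c2 s1 T2 Q) -> tri (HSeq c1 c2) s T Q.
Proof.
move=> le [l1 q1]; have [l2 q2] := q1 (agree_hrun _ _).
by split => [/=|_]; [lia|exact: q2 (agree_hrun _ _)].
Qed.

Lemma tri_if a b c1 c2 s T1 T (Q : state -> Prop) :
  ecost a s + ecost b s + T1 + 2 <= T ->
  (eval a s < eval b s -> tri c1 s T1 Q) ->
  (eval b s <= eval a s -> tri c2 s T1 Q) -> tri (HIf a b c1 c2) s T Q.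
Proof.
move=> le h1 h2; case: (ltnP (eval a s) (eval b s)) => lt.
- have [l q] := h1 lt; split=> [|_]; rewrite /= lt; first by rewrite /=; lia.
  exact: q (agree_hrun _ _).
- have [l q] := h2 lt; split=> [|_]; rewrite /= (leq_gtF lt); first by rewrite /=; lia.
  exact: q (agree_hrun _ _).
Qed.

Lemma tri_for i b c s T B T' (I : nat -> state -> Prop) (Q : state -> Prop) :
  eval b s = B -> ecost b s + B * (T + 6) + 3 <= T' -> I 0 s ->
  (forall j s', j < B -> agree (i :: written c) (awritten c) s s' ->
     I j s' -> tri c (setr s' i j) T (I j.+1)) ->
  (forall s', agree (i :: written c) (awritten c) s s' -> I B s' -> Q s') ->
  tri (HFor i b c) s T' Q.
Proof.
move=> <- le I0 IS IQ.
set F := fun r j => let r' := hrun c (setr r.1 i j) in (r'.1, r.2 + r'.2 + 6).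
pose st j := foldl F (s, 0) (iota 0 j).
have stS j : st j.+1 = F (st j) j by rewrite /st -[j.+1]addn1 iotaD foldl_cat.
have agst j : agree (i :: written c) (awritten c) s (st j).1.
  elim: j => [//|j IH]; rewrite stS /=.
  apply: agree_sub (agree_trans IH (agree_trans (agree_setr i j (agree_refl [::] [::] _)) (agree_hrun c _))).
  + by move=> x; rewrite !(inE, mem_cat); case: (x == i); case: (x \in _).
  + by move=> x; rewrite mem_cat => /orP [].
have H j : j <= eval b s -> I j (st j).1 /\ (st j).2 <= j * (T + 6).
  elim: j => [//|j IH] jB; have [Ij cj] := IH (ltnW jB).
  have [l q] := IS j _ jB (agst j) Ij; rewrite stS; split; first exact: q (agree_hrun _ _).
  by rewrite mulSn /=; lia.
have [IB cB] := H _ (leqnn _).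
by split=> [|_]; [rewrite /= -/F -/(st _); lia|apply: IQ => //; exact: agst].
Qed.

Ltac frame := repeat match goal with
  | ag : agree _ _ _ ?s |- context [fst ?s ?x] => rewrite (proj1 ag x isT)
  | ag : agree _ _ _ ?s |- context [snd ?s ?a ?i] => rewrite (proj2 ag a i isT)
  end.

Definition HFill a i n e := HFor i n (HPut a (EV i) e).

(** The expression may rely on the entries from [j] on being old, which permits in-place updates
    such as that of the hit counts. *)
Lemma tri_fill a i n e s c B T (f : nat -> nat) (Q : state -> Prop) :
  eval n s = B -> ecost n s + B * (c + 16) + 3 <= T ->
  (forall j s', j < B -> agree [:: i] [:: a] s s' ->
     (forall l, l < j -> s'.2 a l = f l) -> (forall l, j <= l -> s'.2 a l = s.2 a l) ->
     s'.1 i = j -> ecost e s' <= c /\ eval e s' = f j) ->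
  (forall s', agree [:: i] [:: a] s s' ->
     (forall j, s'.2 a j = if j < B then f j else s.2 a j) -> Q s') ->
  tri (HFill a i n e) s T Q.
Proof.
move=> eB le he hQ; apply: (tri_for (T := c + 10)
  (I := fun j s' => (forall l, s'.2 a l = if l < j then f l else s.2 a l))) eB _ _ _ _ => //.
- by rewrite -(addnA c).
- move=> j s' jB ag Ij.
  have [] := he j (setr s' i j) jB; rewrite /= ?eqxx //.
  + split => [x xi|b l ba] /=; last exact: (proj2 ag).
    rewrite /upd; case: eqP xi => [->|_ xi]; first by rewrite inE eqxx.
    by rewrite (proj1 ag).
  + by move=> l lj /=; rewrite Ij lj.
  + by move=> l jl /=; rewrite Ij ltnNge jl.
  move=> ce ev; apply: tri_put; first by rewrite /=; lia.
  move=> l /=; rewrite !eqxx ev ltnS leq_eqVlt Ij.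
  by have [->|] := eqVneq l j.
Qed.

(* Connectives on 0/1 values, by truncated subtraction. *)
Definition ENot a := ESub (EC 1) a.
Definition ELt a b := ENot (ENot (ESub b a)).
Definition EAnd a b := ESub (EAdd a b) (EC 1).
Definition EOr a b := ENot (ENot (EAdd a b)).
Definition EEq a b := ENot (EAdd (ESub a b) (ESub b a)).

Lemma eval_lt a b s : eval (ELt a b) s = (eval a s < eval b s).
Proof. by rewrite /=; lia. Qed.
Lemma eval_eq a b s : eval (EEq a b) s = (eval a s == eval b s).
Proof. by rewrite /=; lia. Qed.
Lemma eval_not_gt0 a s : eval (ENot a) s = ~~ (0 < eval a s).
Proof. by rewrite /=; lia. Qed.
Lemma eval_and a b s (x y : bool) : eval a s = x -> eval b s = y ->
  eval (EAnd a b) s = x && y.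
Proof. by rewrite /= => -> ->; case: x y => [] []. Qed.
Lemma eval_or a b s (x y : bool) : eval a s = x -> eval b s = y ->
  eval (EOr a b) s = x || y.
Proof. by rewrite /= => -> ->; case: x y => [] []. Qed.

Lemma sum_gt0 n (b : nat -> bool) :
  (0 < \sum_(j < n) b j) = [exists j : 'I_n, b j].
Proof.
rewrite lt0n sum_nat_eq0 negb_forall; apply: eq_existsb => j.
by rewrite /= eqb0 negbK.
Qed.

(** Variables: [rI] is the number of incidences, [rP] the number of tuples, [rz] the output size.
    Arrays: [aS] input stream, [aOFF] edge positions in it, [aA] incidence matrix with row starts
    [aROW], [aIV] and [aIE] the incidences, [aD] the current tuple as digits, [aX] its vertices,
    [aF] free edges, [aT] current set, [aC] hit counts, [aB] last set found, [aOUT] output. *)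
Notation rk := 1 (only parsing). Notation rm := 2 (only parsing).
Notation rN := 3 (only parsing). Notation rI := 4 (only parsing).
Notation rq := 5 (only parsing). Notation rP := 6 (only parsing).
Notation rfound := 7 (only parsing). Notation rz := 8 (only parsing).
Notation ie := 10 (only parsing). Notation iv := 11 (only parsing).
Notation ii := 12 (only parsing). Notation ij := 13 (only parsing).
Notation it := 14 (only parsing). Notation rp := 16 (only parsing).
Notation rbad := 17 (only parsing). Notation rfree := 18 (only parsing).
Notation ru := 19 (only parsing). Notation rcarry := 20 (only parsing).
Notation rx := 21 (only parsing).
Notation aS := 0 (only parsing). Notation aOFF := 1 (only parsing).
Notation aA := 2 (only parsing). Notation aROW := 3 (only parsing).
Notation aIV := 4 (only parsing). Notation aIE := 5 (only parsing).
Notation aD := 6 (only parsing). Notation aX := 7 (only parsing).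
Notation aF := 8 (only parsing). Notation aT := 9 (only parsing).
Notation aC := 10 (only parsing). Notation aB := 11 (only parsing).
Notation aOUT := 12 (only parsing).

Definition HSkip := HSet ru (EC 0).
Definition EEnt e v := EGet aA (EAdd (EGet aROW e) v).

Definition prep m N (mm : nat -> nat -> bool) (s : state) : Prop :=
  [/\ s.1 rm = m, s.1 rN = N &
   forall e v, e < m -> v < N -> s.2 aA (s.2 aROW e + v) = mm e v].

Lemma prep_agree m N mm s s' W A : agree W A s s' ->
  (rm \notin W) && (rN \notin W) && (aA \notin A) && (aROW \notin A) ->
  prep m N mm s -> prep m N mm s'.
Proof.
move=> [r a] /andP [/andP [/andP [h1 h2] h3] h4] [p1 p2 p3].
by split; rewrite ?r // => e v em vN; rewrite !a ?p3.
Qed.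

(** * Greedy minimisation *)

Definition minimize_step : hcmd :=
  HSeq (HSet ru (EAnd (EGet aT (EV iv)) (ENot (ESum ie (EV rm)
          (EAnd (EEnt (EV ie) (EV iv)) (ELt (EGet aC (EV ie)) (EC 2)))))))
 (HSeq (HPut aT (EV iv) (ESub (EGet aT (EV iv)) (EV ru)))
       (HFill aC ie (EV rm) (ESub (EGet aC (EV ie))
          (EAnd (EEnt (EV ie) (EV iv)) (EV ru))))).
Definition minimize : hcmd := HFor iv (EV rN) minimize_step.

(** * Testing one tuple *)

Lemma eval_sum i b e s B (f : nat -> nat) : eval b s = B ->
  (forall j, j < B -> eval e (setr s i j) = f j) ->
  eval (ESum i b e) s = \sum_(j < B) f j.
Proof. by move=> /= -> h; apply: eq_bigr => j _; exact: h. Qed.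

Lemma eval_exists i b e s B (p : nat -> bool) : eval b s = B ->
  (forall j, j < B -> eval e (setr s i j) = p j) ->
  (0 < eval (ESum i b e) s) = [exists j : 'I_B, p j].
Proof. by move=> eb ee; rewrite (eval_sum eb ee) sum_gt0. Qed.

Lemma prep_setr m N mm s x v : x != rm -> x != rN ->
  prep m N mm s -> prep m N mm (setr s x v).
Proof.
by move=> x1 x2 [p1 p2 p3]; split=> //=; rewrite eq_sym ?(negbTE x1) ?(negbTE x2).
Qed.

Lemma eval_ent m N mm s e v e0 v0 : prep m N mm s ->
  eval e s = e0 -> eval v s = v0 -> e0 < m -> v0 < N ->
  eval (EEnt e v) s = mm e0 v0.
Proof. by move=> [_ _ p3] /= -> -> em vN; rewrite p3. Qed.

Ltac tseq a b := apply: (@tri_seq _ _ _ a _ b).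

Lemma tri_minimize_step m N mm t j s (Q : state -> Prop) : j < N ->
  prep m N mm s -> s.1 iv = j ->
  let g := greedy N m mm t j in
  (forall v, v < N -> s.2 aT v = g v) ->
  (forall e, e < m -> s.2 aC e = cnt N mm g e) ->
  (forall s', agree [:: ru; ie] [:: aT; aC] s s' ->
     let g' := greedy N m mm t j.+1 in
     (forall v, v < N -> s'.2 aT v = g' v) ->
     (forall e, e < m -> s'.2 aC e = cnt N mm g' e) -> Q s') ->
  tri minimize_step s (200 * (m + 1)) Q.
Proof.
move=> jN pr sj g gT gC hQ.
have [p1 p2 p3] := pr.
tseq (80 * (m + 1)) (120 * (m+1)); first by lia.
apply: tri_set.
  rewrite /= !p1 !sum_nat_const !card_ord; lia.
have -> : eval (EAnd (EGet aT (EV iv)) (ENot (ESum ie (EV rm)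
          (EAnd (EEnt (EV ie) (EV iv)) (ELt (EGet aC (EV ie)) (EC 2)))))) s = removable N m mm g j.
  apply: eval_and; first by rewrite /= sj gT.
  rewrite eval_not_gt0 (eval_exists (B := m) (p := fun e => mm e j && (cnt N mm g e < 2))) //.
    by rewrite negb_exists; congr (nat_of_bool _); apply: eq_forallb => e;
       rewrite negb_and -implybE -leqNgt.
  move=> e em; apply: eval_and.
    by apply: (eval_ent (prep_setr _ _ _ pr)) => //.
  by rewrite eval_lt /= gC.
set r := removable _ _ _ _ _.
tseq 30 (90 * (m + 1)); first by lia.
apply: tri_put; first by [].
set s1 := seta _ _ _ _.
have pr1 : prep m N mm s1 by split.
have [q1 _ _] := pr1.
apply: (tri_fill (c := 50) (B := m) (f := cnt N mm (greedy N m mm t j.+1))).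
- exact: q1.
- by rewrite /=; lia.
- move=> e s' em ag _ same se; split; first by [].
  have pr' : prep m N mm s' by apply: prep_agree ag _ pr1.
  transitivity (s'.2 aC e - eval (EAnd (EEnt (EV ie) (EV iv)) (EV ru)) s').
    by rewrite /= se.
  rewrite (eval_and (x := mm e j) (y := r)) ?cnt_greedyS //.
  + by rewrite (same e) //= gC.
  + by apply: eval_ent pr' _ _ _ _ => //=; rewrite (proj1 ag).
  + by rewrite /= (proj1 ag).
- move=> s2 ag2 h2; apply: hQ.
  + split=> [x|a i]; rewrite !inE !negb_or => /andP [h h'].
      by rewrite (proj1 ag2) ?inE //= (negbTE h).
    by rewrite (proj2 ag2) ?inE //= (negbTE h).
  + move=> v vN; rewrite (proj2 ag2) //= sj !gT // -/g -/r.
    have [->|] := eqVneq v j; rewrite ?eqxx ?andbT //.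
    by rewrite /r /removable; case: (g j) => //=; case: [forall _, _].
  + by move=> e em; rewrite h2 em.
Qed.

Lemma tri_minimize m N mm t s (Q : state -> Prop) :
  prep m N mm s ->
  (forall v, v < N -> s.2 aT v = t v) ->
  (forall e, e < m -> s.2 aC e = cnt N mm t e) ->
  (forall s', agree [:: iv; ru; ie] [:: aT; aC] s s' ->
     (forall v, v < N -> s'.2 aT v = greedy N m mm t N v) -> Q s') ->
  tri minimize s (N * (200 * (m + 1) + 6) + 5) Q.
Proof.
move=> pr sT sC hQ; have [p1 p2 p3] := pr.
apply: (tri_for (B := N) (T := 200 * (m + 1)) (I := fun j s' =>
  (forall v, v < N -> s'.2 aT v = greedy N m mm t j v) /\
  (forall e, e < m -> s'.2 aC e = cnt N mm (greedy N m mm t j) e))) => //.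
- by rewrite /=; lia.
- move=> j s' jN ag [h1 h2]; apply: (tri_minimize_step (mm := mm) (t := t) jN) => //=.
  by apply: prep_setr => //; apply: prep_agree ag _ pr.
- move=> s' ag [h1 h2]; apply: hQ => //.
Qed.

Definition pass : hcmd :=
  HSeq (HFill aX iv (EV rN) (ELt (EC 0) (ESum ii (EV rq)
          (EEq (EGet aIV (EGet aD (EV ii))) (EV iv)))))
 (HSeq (HFill aF ie (EV rm) (ENot (ESum iv (EV rN)
          (EAnd (EGet aX (EV iv)) (EEnt (EV ie) (EV iv))))))
 (HSeq (HSet rfree (ESum ie (EV rm) (EGet aF (EV ie))))
 (HSeq (HFill aT iv (EV rN) (EOr (EGet aX (EV iv)) (EAnd
          (ENot (ESum ii (EV rq) (EEnt (EGet aIE (EGet aD (EV ii))) (EV iv))))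
          (ELt (ESum ie (EV rm) (EAnd (EEnt (EV ie) (EV iv)) (EGet aF (EV ie))))
               (EAdd (EV rfree) (ESub (EC 2) (EV rk)))))))
 (HSeq (HFill aC ie (EV rm) (ESum iv (EV rN)
          (EAnd (EGet aT (EV iv)) (EEnt (EV ie) (EV iv)))))
       (HIf (ESum ie (EV rm) (ENot (EGet aC (EV ie)))) (EC 1)
         (HSeq minimize
            (HIf (EV rk) (EAdd (ESum iv (EV rN) (EGet aT (EV iv))) (EC 1))
               (HSeq (HSet rfound (EC 1)) (HFill aB iv (EV rN) (EGet aT (EV iv))))
               HSkip))
         HSkip))))).

Definition success N m mm k vs es : bool :=
  let t := extend N m mm k vs es in
  [forall e : 'I_m, 0 < cnt N mm t e] && (k <= nverts N (greedy N m mm t N)).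

Lemma tri_pass m N mm k vs es s (Q : state -> Prop) :
  prep m N mm s -> s.1 rk = k -> s.1 rq = k - 2 -> k - 2 <= m ->
  (forall i, i < k - 2 -> [/\ s.2 aIV (s.2 aD i) = vs i,
     s.2 aIE (s.2 aD i) = es i & es i < m]) ->
  (forall s', agree (written pass) (awritten pass) s s' ->
     (if success N m mm k vs es then
        s'.1 rfound = 1 /\
        forall v, v < N -> s'.2 aB v = greedy N m mm (extend N m mm k vs es) N v
      else s'.1 rfound = s.1 rfound /\ forall v, s'.2 aB v = s.2 aB v) -> Q s') ->
  tri pass s (2000 * ((m + 1) * (N + 1))) Q.
Proof.
move=> pr sk sq qm hd hQ; have [p1 p2 _] := pr.
apply: (tri_weaken _ (leqnn _) hQ).
set U := (m + 1) * (N + 1).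
have U1 : N <= U by rewrite /U; lia.
have U2 : m <= U by rewrite /U; lia.
have U3 : 1 <= U by rewrite /U; lia.
have U4 : N * m <= U by rewrite /U; lia.
(* Here k - 2 <= m enters: scanning the tuple for every vertex stays within O(mn). *)
have U5 : N * (k - 2) <= U by apply: leq_trans U4; rewrite leq_mul2l qm orbT.
tseq (200 * U) (1800 * U); first by lia.
apply: (tri_fill (c := 60 * (k - 2) + 30) (B := N) (f := sel (k - 2) vs)).
- exact: p2.
- rewrite /=; lia.
- move=> v s1 vN ag _ _ sv; split.
    by rewrite /=; frame; rewrite sq !sum_nat_const !card_ord; lia.
  rewrite eval_lt [eval (EC 0) _]/=; congr nat_of_bool; apply: (eval_exists (p := fun i => vs i == v)).
    by rewrite /=; frame.
  move=> i iq; rewrite eval_eq /=; frame; rewrite sv; by have [-> _ _] := hd i iq.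
move=> s1 ag1 X1; have pr1 := prep_agree ag1 isT pr; have [q11 q12 _] := pr1.
have mN : m * N <= U by rewrite /U; lia.
tseq (200 * U) (1600 * U); first by lia.
apply: (tri_fill (c := 60 * N + 30) (B := m) (f := free N mm (k - 2) vs)).
- exact: q11.
- rewrite /=; lia.
- move=> e s2 em ag _ _ se; have pr2 := prep_agree ag isT pr1; have [q21 q22 _] := pr2.
  split; first by rewrite /= q22 !sum_nat_const !card_ord; lia.
  rewrite eval_not_gt0 (eval_exists (B := N) (p := fun v => sel (k - 2) vs v && mm e v)) //.
  move=> v vN; apply: eval_and; first by rewrite /=; frame; rewrite X1 vN.
  by apply: (eval_ent (prep_setr _ _ _ pr2)) => //=.
move=> s2 ag2 F2; have pr2 := prep_agree ag2 isT pr1; have [q21 q22 _] := pr2.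
tseq (50 * U) (1550 * U); first by lia.
apply: tri_set; first by rewrite /= q21 !sum_nat_const !card_ord; lia.
rewrite (eval_sum (B := m) (f := free N mm (k - 2) vs)) //; last first.
  by move=> e em; rewrite /= F2 em.
rewrite -/(nfree N m mm (k - 2) vs).
set s3 := setr _ _ _; have pr3 : prep m N mm s3 by exact: prep_setr.
tseq (400 * U) (1150 * U); first by lia.
apply: (tri_fill (c := 60 * (k - 2) + 60 * m + 60) (B := N) (f := extend N m mm k vs es)).
- exact: q22.
- by rewrite /=; lia.
- move=> v s4 vN ag _ _ sv; have pr4 := prep_agree ag isT pr3; have [q41 q42 _] := pr4.
  have fr0 x : x \notin [:: iv; ie; rfree] -> s4.1 x = s.1 x.
    rewrite !inE !negb_or => /and3P [x1 x2 x3]; rewrite (proj1 ag) ?inE //= (negbTE x3).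
    by rewrite (proj1 ag2) ?inE // (proj1 ag1) ?inE.
  split.
    by rewrite /= q41 fr0 // sq !sum_nat_const !card_ord; lia.
  apply: eval_or; first by rewrite /= sv; frame; rewrite /s3 /=; frame; rewrite X1 vN.
  apply: eval_and.
    rewrite eval_not_gt0 (eval_exists (B := k - 2) (p := fun i => mm (es i) v)) //.
      by rewrite /= fr0.
    move=> i iq; have [_ d2 d3] := hd i iq.
    apply: (eval_ent (prep_setr _ _ _ pr4)) => //=.
    by frame; rewrite /s3 /=; frame.
  rewrite eval_lt; congr (nat_of_bool (_ < _)).
    rewrite (eval_sum (B := m) (f := fun e => mm e v && free N mm (k - 2) vs e)) //.
    move=> e em; apply: eval_and; first by apply: (eval_ent (prep_setr _ _ _ pr4)) => //=.
    by rewrite /=; frame; rewrite /s3 /= F2 em.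
  by rewrite /=; frame; rewrite /s3 /=; frame; rewrite sk.
move=> s4 ag4 T4; have pr4 := prep_agree ag4 isT pr3; have [q41 q42 _] := pr4.
set t0 := extend N m mm k vs es in T4.
tseq (200 * U) (950 * U); first by lia.
apply: (tri_fill (c := 60 * N + 30) (B := m) (f := cnt N mm t0)).
- exact: q41.
- by rewrite /=; lia.
- move=> e s5 em ag _ _ se; have pr5 := prep_agree ag isT pr4; have [q51 q52 _] := pr5.
  split; first by rewrite /= q52 !sum_nat_const !card_ord; lia.
  rewrite (eval_sum (B := N) (f := fun v => t0 v && mm e v)) //.
  move=> v vN; apply: eval_and; first by rewrite /=; frame; rewrite T4 vN.
  by apply: (eval_ent (prep_setr _ _ _ pr5)) => //=.
move=> s5 ag5 C5; have pr5 := prep_agree ag5 isT pr4; have [q51 q52 _] := pr5.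
have T5 v : v < N -> s5.2 aT v = t0 v by move=> vN; frame; rewrite T4 vN.
(* A failing test leaves the verdict and the set found by earlier tuples alone. *)
have stay s' : s'.1 rfound = s5.1 rfound -> (forall v, s'.2 aB v = s5.2 aB v) ->
    s'.1 rfound = s.1 rfound /\ forall v, s'.2 aB v = s.2 aB v.
  move=> -> hB; split; first by frame; rewrite /s3 /=; frame.
  by move=> v; rewrite hB; frame; rewrite /s3 /=; frame.
set cond := ESum _ _ _.
have condE : (0 < eval cond s5) = ~~ [forall e : 'I_m, 0 < cnt N mm t0 e].
  rewrite (eval_exists (B := m) (p := fun e => ~~ (0 < cnt N mm t0 e))) ?negb_forall //.
  by move=> e em; rewrite eval_not_gt0 /= C5 em.
apply: (tri_if (T1 := 800 * U)).
- by rewrite /= q51 !sum_nat_const !card_ord; lia.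
- rewrite [eval (EC 1) _]/= => lt1.
  have ht0 : [forall e : 'I_m, 0 < cnt N mm t0 e] by apply: contraLR lt1; rewrite -condE; lia.
  have NU : N * (200 * (m + 1) + 6) + 5 <= 211 * U.
    rewrite mulnDr; have -> : N * (200 * (m + 1)) = 200 * (N * (m + 1)) by lia.
    have : N * (m + 1) <= U by rewrite mulnC leq_mul2l; lia.
    lia.
  tseq (211 * U) (300 * U); first by lia.
  apply: tri_weaken (NU) (fun _ _ h => h).
  apply: (tri_minimize pr5 T5) => [e em|s6 ag6 T6]; first by rewrite C5 em.
  have pr6 := prep_agree ag6 isT pr5; have [q61 q62 _] := pr6.
  have szE : eval (ESum iv (EV rN) (EGet aT (EV iv))) s6 = nverts N (greedy N m mm t0 N).
    by rewrite (eval_sum (B := N) (f := greedy N m mm t0 N)) // => v vN /=; rewrite T6.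
  have kE : eval (EV rk) s6 = k by rewrite /=; frame; rewrite /s3 /=; frame.
  have sizeE : eval (EAdd (ESum iv (EV rN) (EGet aT (EV iv))) (EC 1)) s6
      = (nverts N (greedy N m mm t0 N)).+1 by rewrite -szE /= addn1.
  apply: (tri_if (T1 := 100 * U)).
  + by rewrite /= q62 !sum_nat_const !card_ord; lia.
  + rewrite kE sizeE ltnS => kn.
    tseq (10 * U) (80 * U); first by lia.
    apply: tri_set; first by rewrite /=; lia.
    apply: (tri_fill (c := 20) (B := N) (f := greedy N m mm t0 N)).
    * exact: q62.
    * by rewrite /=; lia.
    * move=> v s7 vN ag _ _ sv; split; first by [].
      by rewrite /= sv; frame; rewrite /= T6.
    * move=> s7 ag7 B7; rewrite /success -/t0 ht0 kn /=; split; first by frame.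
      by move=> v vN; rewrite B7 vN.
  + rewrite kE sizeE => kn; apply: tri_set; first by rewrite /=; lia.
    rewrite /success -/t0 ht0 leqNgt kn /=.
    by apply: stay => [|v] /=; frame.
- rewrite [eval (EC 1) _]/= condE => ht0; apply: tri_set; first by rewrite /=; lia.
  rewrite /success -/t0 (negbTE ht0) /=.
  exact: stay.
Qed.

(** * Enumerating the tuples *)

(** Adds one to a number in base [rI], lowest digit first, with the carry pushed through all
    positions. *)
Definition incr : hcmd :=
  HSeq (HSet rcarry (EC 1))
 (HFor ii (EV rq)
   (HSeq (HSet rx (EAdd (EGet aD (EV ii)) (EV rcarry)))
   (HSeq (HSet rcarry (EEq (EV rx) (EV rI)))
         (HIf (EC 0) (EV rcarry) (HPut aD (EV ii) (EC 0)) (HPut aD (EV ii) (EV rx)))))).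

Definition digit b i x : nat := (x %/ b ^ i) %% b.

(** The carry into position [i] when passing from [x] to its successor is 1 exactly if [b ^ i]
    divides [x.+1]. *)
Lemma digitS b i x : 0 < b ->
  let y := digit b i x + (b ^ i %| x.+1) in
  digit b i x.+1 = (if y == b then 0 else y) /\ (y == b) = (b ^ i.+1 %| x.+1).
Proof.
move=> b0 y; rewrite /y /digit; have bi : 0 < b ^ i by rewrite expn_gt0 b0.
have lt : (x %/ b ^ i) %% b < b by rewrite ltn_mod.
have -> : x.+1 %/ b ^ i = (b ^ i %| x.+1) + x %/ b ^ i by rewrite divnS.
have [d|nd] := boolP (b ^ i %| x.+1); last first.
  rewrite addn0 add0n ltn_eqF //; split=> //.
  by symmetry; apply: contraNF nd => h; apply: dvdn_trans h; rewrite expnS dvdn_mull.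
have e : x.+1 = (x %/ b ^ i).+1 * b ^ i by rewrite -{1}(divnK d) divnS // d.
have -> : (b ^ i.+1 %| x.+1) = (b %| (x %/ b ^ i).+1) by rewrite {1}e expnS dvdn_pmul2r.
rewrite add1n addn1.
set z := x %/ b ^ i in lt *; split.
  rewrite -[z.+1]addn1 -modnDml addn1; case: eqP => [->|ne]; first by rewrite modnn.
  by rewrite modn_small // ltn_neqAle lt andbT; apply/eqP.
rewrite /dvdn -[z.+1]addn1 -modnDml addn1; case: eqP => [->|ne]; first by rewrite modnn.
by rewrite modn_small // ltn_neqAle lt andbT; apply/eqP.
Qed.

Lemma tri_incr b q x s (Q : state -> Prop) : 0 < b ->
  s.1 rI = b -> s.1 rq = q -> (forall i, i < q -> s.2 aD i = digit b i x) ->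
  (forall s', agree (written incr) (awritten incr) s s' ->
    (forall i, i < q -> s'.2 aD i = digit b i x.+1) -> Q s') ->
  tri incr s (100 * (q + 1)) Q.
Proof.
move=> b0 sI sq sD hQ; apply: (tri_weaken _ (leqnn _) hQ).
tseq 10 (90 * (q + 1)); first by lia.
apply: tri_set => //.
apply: (tri_for (B := q) (T := 84) (I := fun j s' =>
  s'.1 rcarry = (b ^ j %| x.+1) /\
  forall i, i < q -> s'.2 aD i = digit b i (if i < j then x.+1 else x))) => /=.
- by [].
- by lia.
- by rewrite expn0 dvd1n.
- move=> j s1 jq ag [h1 h2]; have [y1 y2] := digitS j x b0.
  have dj : s1.2 aD j = digit b j x by rewrite h2 // ltnn.
  tseq 20 60 => //; apply: tri_set => //.
  tseq 20 40 => //; apply: tri_set => //.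
  have -> : eval (EEq (EV rx) (EV rI)) (setr (setr s1 ii j) rx
     (eval (EAdd (EGet aD (EV ii)) (EV rcarry)) (setr s1 ii j))) = (b ^ j.+1 %| x.+1).
    by rewrite eval_eq /= dj h1; frame; rewrite /= sI y2.
  have new i : i < q -> (if i == j then digit b j x.+1 else s1.2 aD i) =
      digit b i (if i < j.+1 then x.+1 else x).
    move=> iq; rewrite ltnS leq_eqVlt; have [->|ne] //= := eqVneq i j.
    by rewrite h2.
  apply: (tri_if (T1 := 20)) => //= [|]; rewrite ?lt0b ?leqn0 ?eqb0 => c;
    apply: tri_put => //=; split=> // i iq; rewrite -new //; case: eqP => // _.
  + by rewrite y1 y2 c.
  + by rewrite y1 y2 (negbTE c) dj h1.
- by move=> s1 _ [_ h] i iq; rewrite h // iq.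
Qed.

(** The counter visits every tuple, which is what turns failure of all tests into a negative
    answer. *)
Lemma digit_surj b q (d : nat -> nat) : (forall i, i < q -> d i < b) ->
  exists2 x, x < b ^ q & forall i, i < q -> digit b i x = d i.
Proof.
elim: q d => [|q IH] d hd; first by exists 0; rewrite ?expn0.
have [x xb hx] := IH (fun i => d i.+1) (fun i iq => hd i.+1 iq).
have b0 : 0 < b by apply: leq_ltn_trans (hd 0 _).
have d0 := hd 0 (ltn0Sn _).
exists (x * b + d 0).
  by rewrite expnSr; apply: leq_trans (_ : x.+1 * b <= _); [rewrite mulSn; lia|rewrite leq_mul2r xb orbT].
case=> [_|i iq]; first by rewrite /digit expn0 divn1 modnMDl modn_small.
rewrite -hx // /digit expnS divnMA; congr (_ %/ _ %% _).
by rewrite divnMDl // divn_small // addn0.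
Qed.

Lemma greedy_ext N m mm t t' j : t =1 t' -> greedy N m mm t j =1 greedy N m mm t' j.
Proof.
move=> e; elim: j => //= j IH v; rewrite IH /removable IH; congr (_ && ~~ (_ && (_ && _))).
apply: eq_forallb => x; congr (_ ==> (_ < _)).
by apply: eq_bigr => i _; rewrite IH.
Qed.

Lemma success_ext N m mm k vs es vs' es' :
  (forall i, i < k - 2 -> vs i = vs' i) -> (forall i, i < k - 2 -> es i = es' i) ->
  success N m mm k vs es = success N m mm k vs' es'.
Proof.
move=> ev ee.
have es1 : sel (k - 2) vs =1 sel (k - 2) vs'.
  by move=> v; apply: eq_existsb => i; rewrite ev.
have ef e : free N mm (k - 2) vs e = free N mm (k - 2) vs' e.
  by congr (~~ _); apply: eq_existsb => v; rewrite es1.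
have et : extend N m mm k vs es =1 extend N m mm k vs' es'.
  move=> v; rewrite /extend es1; congr (_ || ~~ _ && (_ < _ + _)).
  - by apply: eq_existsb => i; rewrite ee.
  - by apply: eq_bigr => e _; rewrite ef.
  - by apply: eq_bigr => e _; rewrite ef.
rewrite /success; congr (_ && (_ <= _)).
  by apply: eq_forallb => e; congr (_ < _); apply: eq_bigr => i _; rewrite et.
by apply: eq_bigr => v _; rewrite (greedy_ext _ _ _ _ et).
Qed.

Definition search : hcmd := HFor it (EV rP) (HSeq pass incr).

(** All tuples are tried without early exit; the invariant is either failure so far or a stored
    success. *)
Lemma tri_search N m mm k b (iV iE : nat -> nat) s (Q : state -> Prop) :
  prep m N mm s -> s.1 rk = k -> s.1 rq = k - 2 -> k - 2 <= m ->
  s.1 rI = b -> 0 < b -> s.1 rP = b ^ (k - 2) ->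
  (forall j, j < b -> [/\ s.2 aIV j = iV j, s.2 aIE j = iE j & iE j < m]) ->
  (forall i, i < k - 2 -> s.2 aD i = 0) -> s.1 rfound = 0 ->
  (forall s', agree (written search) (awritten search) s s' ->
     let ok x := success N m mm k (fun i => iV (digit b i x)) (fun i => iE (digit b i x)) in
     (s'.1 rfound = 0 /\ forall x, x < b ^ (k - 2) -> ~~ ok x) \/
     (s'.1 rfound = 1 /\ exists vs es, success N m mm k vs es /\
        forall v, v < N -> s'.2 aB v = greedy N m mm (extend N m mm k vs es) N v) -> Q s') ->
  tri search s (b ^ (k - 2) * (2200 * ((m + 1) * (N + 1))) + 5) Q.
Proof.
move=> pr sk sq qm sI b0 sP hI sD sf hQ; apply: (tri_weaken _ (leqnn _) hQ).
pose ok x := success N m mm k (fun i => iV (digit b i x)) (fun i => iE (digit b i x)).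
have bT i x : digit b i x < b by rewrite ltn_mod.
apply: (tri_for (B := b ^ (k - 2)) (T := 2100 * ((m + 1) * (N + 1))) (I := fun j s' =>
  (forall i, i < k - 2 -> s'.2 aD i = digit b i j) /\
  ((s'.1 rfound = 0 /\ forall x, x < j -> ~~ ok x) \/
   (s'.1 rfound = 1 /\ exists vs es, success N m mm k vs es /\
        forall v, v < N -> s'.2 aB v = greedy N m mm (extend N m mm k vs es) N v)))).
- by [].
- have : b ^ (k - 2) * (2100 * ((m + 1) * (N + 1)) + 6)
      <= b ^ (k - 2) * (2200 * ((m + 1) * (N + 1))) by rewrite leq_mul2l; lia.
  by rewrite /=; lia.
- split; last by left.
  by move=> i iq; rewrite sD // /digit div0n mod0n.
- move=> j s1 jB ag [hD hF]; set s2 := setr _ _ _.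
  have pr2 : prep m N mm s2 by apply: prep_setr => //; exact: prep_agree ag isT pr.
  tseq (2000 * ((m + 1) * (N + 1))) (100 * ((k - 2) + 1)); first by nia.
  apply: (tri_pass (k := k) (vs := fun i => iV (digit b i j)) (es := fun i => iE (digit b i j)) pr2).
  + by rewrite /s2 /=; frame.
  + by rewrite /s2 /=; frame.
  + by [].
  + by move=> i iq; rewrite /s2 /=; frame; rewrite hD //; exact: hI.
  move=> s3 ag3; rewrite -/(ok j) => h3; apply: (tri_incr b0 (x := j)).
  + by frame; rewrite /s2 /=; frame.
  + by frame; rewrite /s2 /=; frame.
  + by move=> i iq; frame; rewrite /s2 /= hD.
  move=> s4 ag4 D4; split=> //; frame.
  have aB4 v : s4.2 aB v = s3.2 aB v by frame.
  case: (boolP (ok j)) h3 => okj [f3 B3].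
  + right; split; first by [].
    exists (fun i => iV (digit b i j)), (fun i => iE (digit b i j)); split=> // v vN.
    by rewrite aB4 B3.
  + case: hF => [[f1 n1]|[f1 [vs [es [su B1]]]]].
      left; rewrite f3 /s2 /=; split=> // x; rewrite ltnS leq_eqVlt => /orP [/eqP ->|] //.
      exact: n1.
    right; rewrite f3 /s2 /=; split=> //; exists vs, es; split=> // v vN.
    by rewrite aB4 B3 /s2 /= B1.
- by move=> s' ag [_ h].
Qed.

Lemma success_sound N m mm k vs es : success N m mm k vs es ->
  let t := greedy N m mm (extend N m mm k vs es) N in
  [/\ hits N m mm t, critical N m mm t & k <= nverts N t].
Proof.
move=> /andP [/forallP h kn] t; split=> //; last exact: greedy_critical.
by apply: greedy_hits => // e em; exact: (h (Ordinal em)).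
Qed.

(** * Reading the hypergraph *)

Definition stream (ws : seq (seq nat)) : seq nat :=
  flatten [seq size w :: w | w <- ws].
Definition offset ws j : nat := size (stream (take j ws)).
Notation row ws j := (nth [::] ws j).

Lemma stream_drop ws j : j < size ws ->
  drop (offset ws j) (stream ws) = size (row ws j) :: row ws j ++ stream (drop j.+1 ws).
Proof.
move=> js; rewrite /offset -{2}(cat_take_drop j ws) /stream map_cat flatten_cat drop_size_cat //.
by rewrite (drop_nth [::] js).
Qed.

Lemma stream_size ws j : j < size ws ->
  nth 0 (stream ws) (offset ws j) = size (row ws j).
Proof. by move=> js; rewrite -[offset ws j]addn0 -nth_drop stream_drop. Qed.

Lemma stream_nth ws j l : j < size ws -> l < size (row ws j) ->
  nth 0 (stream ws) (offset ws j + (1 + l)) = nth 0 (row ws j) l.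
Proof. by move=> js ls; rewrite -nth_drop stream_drop // add1n /= nth_cat ls. Qed.

Lemma offset0 ws : offset ws 0 = 0.
Proof. by rewrite /offset take0. Qed.

Lemma offsetS ws j : j < size ws ->
  offset ws j.+1 = offset ws j + size (row ws j) + 1.
Proof.
move=> js; rewrite /offset (take_nth [::] js) /stream map_rcons flatten_rcons size_cat /=.
by rewrite addnS addn1.
Qed.

Lemma offset_size ws : offset ws (size ws) = size (stream ws).
Proof. by rewrite /offset take_size. Qed.

(** The range includes the cell just past the stream, which must read 0: this zero is the
    terminator. *)
Definition rep_stream ws (s : state) : Prop :=
  forall i, i <= size (stream ws) -> s.2 aS i = nth 0 (stream ws) i.

Lemma offset_le ws j : j <= size ws -> offset ws j <= size (stream ws).
Proof.
move=> js; rewrite /offset -{2}(cat_take_drop j ws) /stream map_cat flatten_cat size_cat.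
exact: leq_addr.
Qed.

Lemma rep_stream_size ws s j : rep_stream ws s -> j < size ws ->
  s.2 aS (offset ws j) = size (row ws j).
Proof. by move=> h js; rewrite h ?stream_size // offset_le // ltnW. Qed.

Lemma rep_stream_nth ws s j l : rep_stream ws s -> j < size ws ->
  l < size (row ws j) -> s.2 aS (offset ws j + (1 + l)) = nth 0 (row ws j) l.
Proof.
move=> h js ls; rewrite h ?stream_nth //.
apply: leq_trans (offset_le js); rewrite offsetS //; lia.
Qed.

Definition offsets : hcmd :=
  HSeq (HSet rp (EC 0))
 (HSeq (HFor ie (EV rm) (HSeq (HPut aOFF (EV ie) (EV rp))
          (HSet rp (EAdd (EV rp) (EAdd (EGet aS (EV rp)) (ELt (EC 0) (EGet aS (EV rp))))))))
       (HSet rbad (ESum ie (EV rm) (ELt (EGet aS (EGet aOFF (EV ie))) (EC 1))))).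

(** [ws] holds the edges before the first empty one. The pointer advances only over a nonzero size,
    so it stalls at the terminator, and [rbad] is positive iff fewer than [m] edges were read. *)
Lemma tri_offsets ws m s (Q : state -> Prop) :
  all (fun w => 0 < size w) ws -> size ws <= m -> s.1 rm = m -> rep_stream ws s ->
  (forall s', agree (written offsets) (awritten offsets) s s' ->
     (forall j, j < size ws -> s'.2 aOFF j = offset ws j) /\
     (0 < s'.1 rbad) = (size ws < m) -> Q s') ->
  tri offsets s (200 * (m + 1)) Q.
Proof.
move=> /(all_nthP [::]) ne fm sm hS hQ; apply: (tri_weaken _ (leqnn _) hQ).
set f := size ws in fm hS *.
tseq 10 (190 * (m + 1)); first by lia.
apply: tri_set => //.
tseq (100 * (m + 1)) (90 * (m + 1)); first by lia.
apply: (tri_for (B := m) (T := 90) (I := fun j s' => s'.1 rp = offset ws (minn j f) /\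
  forall l, l < j -> s'.2 aOFF l = offset ws (minn l f))).
- by [].
- by rewrite /=; lia.
- by rewrite min0n offset0.
- move=> j s1 jm ag [h1 h2].
  tseq 20 60 => //; apply: tri_put => //; apply: tri_set => //=.
  have hS1 i : s1.2 aS i = s.2 aS i by frame.
  split; last first.
    move=> l; rewrite ltnS leq_eqVlt; have [->|_] //= := eqVneq l j; exact: h2.
  rewrite h1 !hS1; have /orP [fj|jf] := leqVgt f j; last first.
    rewrite (minn_idPl (ltnW jf)) (minn_idPl jf) (rep_stream_size hS jf) offsetS //.
    by have := ne j jf; lia.
  rewrite !(minn_idPr _) ?leqW // offset_size hS // nth_default //; lia.
move=> s1 ag1 [_ h2]; apply: tri_set.
  by rewrite /=; frame; rewrite /= sm !sum_nat_const !card_ord; lia.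
split => /=; first by move=> j jf; rewrite h2 ?(minn_idPl (ltnW jf)) // (leq_trans jf).
have := @eval_exists ie (EV rm) (ELt (EGet aS (EGet aOFF (EV ie))) (EC 1)) s1 m (fun e => f <= e).
move=> /= ->.
- apply/existsP/idP => [[e]|fm']; first by move/leq_ltn_trans; apply.
  by exists (Ordinal fm') => /=.
- by frame; rewrite /= sm.
- move=> e em; rewrite /= h2 //; frame; rewrite /=.
  have /orP [fe|ef] := leqVgt f e; last first.
    by rewrite (minn_idPl (ltnW ef)) (rep_stream_size hS ef); have := ne e ef; lia.
  by rewrite (minn_idPr fe) offset_size hS // nth_default // fe.
Qed.

(** The number [n] occurs in the analysis only; the program works with the bound [rN] computed by
    [span]. *)
Definition small_rows n (ws : seq (seq nat)) : Prop :=
  forall j, size (row ws j) <= n /\ forall v, v \in row ws j -> v < n.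

Definition rep_rows ws (s : state) : Prop :=
  s.1 rm = size ws /\ forall j, j < size ws ->
    s.2 aS (s.2 aOFF j) = size (row ws j) /\
    forall l, l < size (row ws j) -> s.2 aS (s.2 aOFF j + (1 + l)) = nth 0 (row ws j) l.

Lemma rep_rows_agree ws s s' W A : agree W A s s' ->
  (rm \notin W) && (aS \notin A) && (aOFF \notin A) -> rep_rows ws s -> rep_rows ws s'.
Proof.
move=> [r a] /andP [/andP [h1 h2] h3] [p1 p2]; split; rewrite ?r // => j jm.
by have [q1 q2] := p2 j jm; split=> [|l lj]; rewrite !a ?q1 ?q2.
Qed.

Definition Entry := EGet aS (EAdd (EGet aOFF (EV ie)) (EAdd (EC 1) (EV ij))).
Definition for_rows c := HFor ie (EV rm) (HFor ij (EGet aS (EGet aOFF (EV ie))) c).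

(** In the invariant [I j v], the list [v] is the part of edge [j] already read. *)
Lemma tri_for_rows ws n c s T (I : nat -> seq nat -> state -> Prop) (Q : state -> Prop) :
  let ag := agree (ie :: ij :: written c) (awritten c) s in
  (rm \notin written c) && (ie \notin written c) &&
    (aS \notin awritten c) && (aOFF \notin awritten c) ->
  rep_rows ws s -> small_rows n ws ->
  I 0 [::] s ->
  (forall j s' v, I j v s' -> I j v (setr s' ie j)) ->
  (forall j v w s', j < size ws -> ag s' -> row ws j = rcons v w ++ drop (size v).+1 (row ws j) ->
     I j v s' -> s'.1 ie = j -> s'.2 aS (s'.2 aOFF j + (1 + size v)) = w ->
     tri c (setr s' ij (size v)) T (I j (rcons v w))) ->
  (forall j s', j < size ws -> I j (row ws j) s' -> I j.+1 [::] s') ->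
  (forall s', ag s' -> I (size ws) [::] s' -> Q s') ->
  tri (for_rows c) s (size ws * (n * (T + 6) + 50) + 5) Q.
Proof.
move=> ag /andP [/andP [/andP [w1 w2] w3] w4] hS sm I0 Ie IS IN IQ.
have [h1 h2] := hS.
apply: (tri_for (B := size ws) (T := n * (T + 6) + 44) (I := fun j => I j [::])) => //=.
- by rewrite -addnA; lia.
- move=> j s1 jm ag1 I1.
  have hS1 : rep_rows ws s1.
    by apply: rep_rows_agree ag1 _ hS; rewrite !inE /= w1 w3 w4.
  have [_ /(_ j jm) [r1 r2]] := hS1.
  have [sj _] := sm j.
  apply: (tri_for (B := size (row ws j)) (T := T) (I := fun l => I j (take l (row ws j)))).
  + by rewrite /= r1.
  + rewrite /=; have : size (row ws j) * (T + 6) <= n * (T + 6) by rewrite leq_mul2r sj orbT.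
    by lia.
  + by rewrite take0; exact: Ie.
  + move=> l s2 lj ag2 I2.
    have ag02 : ag s2.
      apply: agree_sub (agree_trans ag1 (agree_trans (agree_setr ie j (agree_refl [::] [::] _)) ag2)).
        move=> x; rewrite !(inE, mem_cat); case: (x == 10); case: (x == 13) => //=.
        by rewrite !orbb.
      by move=> x; rewrite !mem_cat orbb.
    have sz : size (take l (row ws j)) = l by rewrite size_take lj.
    rewrite (take_nth 0 lj); have := IS j (take l (row ws j)) (nth 0 (row ws j) l) s2 jm ag02.
    rewrite sz; apply => //.
    * by rewrite -take_nth // cat_take_drop.
    * by rewrite (proj1 ag2) //= inE negb_or w2.
    * by rewrite !(proj2 ag2) //= r2.
  + by move=> s2 _; rewrite take_size; exact: IN.
Qed.

(** With truncated subtraction, N + ((x + 1) - N) is the maximum of N and x + 1. *)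
Definition span : hcmd :=
  HSeq (HSet rN (EC 0))
       (for_rows (HSet rN (EAdd (EV rN) (ESub (EAdd Entry (EC 1)) (EV rN))))).

Lemma tri_span ws n s (Q : state -> Prop) : rep_rows ws s -> small_rows n ws ->
  (forall s', agree (written span) (awritten span) s s' ->
     s'.1 rN <= n /\ (forall j, j < size ws -> forall v, v \in row ws j -> v < s'.1 rN) ->
     Q s') ->
  tri span s (100 * (size ws * (n + 1) + 1)) Q.
Proof.
move=> hS sm hQ; apply: (tri_weaken _ (leqnn _) hQ).
tseq 10 (90 * (size ws * (n + 1) + 1)); first by lia.
apply: tri_set => //.
apply: (@tri_weaken _ _ (size ws * (n * (50 + 6) + 50) + 5)); last by move=> s' _; exact: id.
  apply: (@tri_for_rows ws n _ _ _ (fun j v s' => [/\ s'.1 rN <= n,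
    forall e, e < j -> forall x, x \in row ws e -> x < s'.1 rN &
    forall x, x \in v -> x < s'.1 rN])) => //.
  - move=> j v w s1 jm ag re [I1 I2 I3] se ew; apply: tri_set => //=.
    have wn : w < n by apply: (proj2 (sm j)); rewrite re mem_cat mem_rcons inE eqxx.
    rewrite se ew; split; first by lia.
      by move=> e ej x xe; have := I2 e ej x xe; lia.
    by move=> x; rewrite mem_rcons inE => /orP [/eqP ->|/I3]; lia.
  - move=> j s1 jm [I1 I2 I3]; split=> // e; rewrite ltnS leq_eqVlt => /orP [/eqP ->|] //.
    exact: I2.
  - by move=> s1 _ [I1 I2 _].
by nia.
Qed.

Definition matrix : hcmd :=
  HSeq (HSet rp (EC 0))
 (HSeq (HFor ie (EV rm) (HSeq (HPut aROW (EV ie) (EV rp))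
                              (HSet rp (EAdd (EV rp) (EV rN)))))
 (HSeq (HFor ie (EV rm) (HFor iv (EV rN)
          (HPut aA (EAdd (EGet aROW (EV ie)) (EV iv)) (EC 0))))
       (for_rows (HPut aA (EAdd (EGet aROW (EV ie)) Entry) (EC 1))))).

Lemma divmod_uniq N e x e' x' : x < N -> x' < N ->
  (e * N + x == e' * N + x') = (e == e') && (x == x').
Proof.
move=> xN xN'; apply/eqP/andP => [h|[/eqP -> /eqP ->] //].
have N0 : 0 < N by lia.
have e1 : e = e'.
  have := congr1 (divn^~ N) h; rewrite !divnMDl // !divn_small // !addn0; exact: id.
by split; apply/eqP => //; move: h; rewrite e1 => /addnI.
Qed.

Lemma tri_matrix ws n N s (Q : state -> Prop) :
  rep_rows ws s -> small_rows n ws -> s.1 rN = N -> N <= n ->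
  (forall j, j < size ws -> forall v, v \in row ws j -> v < N) ->
  (forall s', agree (written matrix) (awritten matrix) s s' ->
     prep (size ws) N (fun e v => v \in row ws e) s' -> Q s') ->
  tri matrix s (300 * (size ws * (n + 1) + 1)) Q.
Proof.
move=> hS sm sN Nn wN hQ; apply: (tri_weaken _ (leqnn _) hQ).
have [sm1 _] := hS; set m := size ws in sm1 wN *.
set U := m * (n + 1) + 1.
have U1 : m <= U by rewrite /U; lia.
have U2 : 1 <= U by rewrite /U; lia.
tseq (10 * U) (290 * U); first by lia.
apply: tri_set; first by rewrite /=; lia.
tseq (60 * U) (230 * U); first by lia.
apply: (tri_for (B := m) (T := 40) (I := fun j s' => s'.1 rp = j * N /\
    forall l, l < j -> s'.2 aROW l = l * N)).
- by [].
- by rewrite /=; lia.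
- by [].
- move=> j s1 jm ag [h1 h2].
  tseq 20 20 => //; apply: tri_put => //; apply: tri_set => //=.
  rewrite h1; frame; rewrite /= sN; split; first by lia.
  by move=> l; rewrite ltnS leq_eqVlt; have [->|_] //= := eqVneq l j; exact: h2.
move=> s1 ag1 [_ R1].
tseq (90 * U) (140 * U); first by lia.
have row_agree s' : agree [:: ie; iv; ij] [:: aA] s1 s' ->
    (forall e, e < m -> s'.2 aROW e = e * N) /\ s'.1 rN = N.
  by move=> ag; split=> [e em|]; frame; rewrite ?R1.
apply: (tri_for (B := m) (T := n * 46 + 12) (I := fun j s' =>
   forall e x, e < j -> x < N -> s'.2 aA (e * N + x) = 0)) => //.
- by rewrite /=; frame.
- by rewrite /= /U; nia.
- move=> j s2 jm ag I2; have [R2 N2] : (forall e, e < m -> s2.2 aROW e = e * N) /\ s2.1 rN = N.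
    by apply: row_agree; apply: agree_sub ag => x //; rewrite !inE => /orP [] ->; rewrite ?orbT.
  apply: (tri_for (B := N) (T := 40) (I := fun l s' =>
     forall e x, (e < j) && (x < N) || (e == j) && (x < l) -> s'.2 aA (e * N + x) = 0)).
  + by rewrite /= N2.
  + by rewrite /=; nia.
  + by move=> e x; rewrite ltn0 andbF orbF => /andP [ej xN] /=; apply: I2.
  + move=> l s3 lN ag3 I3; apply: tri_put => //= e x.
    have -> : s3.1 ie = j by frame; rewrite /=.
    frame; rewrite /= R2 //; case: ifP => // h hx; apply: I3.
    case/orP: hx => [-> //|/andP [/eqP ej]]; rewrite ltnS leq_eqVlt => /orP [/eqP xl|xl].
      by rewrite ej xl eqxx in h.
    by rewrite ej eqxx xl orbT.
  + move=> s3 _ I3 e x; rewrite ltnS leq_eqVlt => ej xN; apply: I3.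
    by rewrite xN !andbT orbC.
move=> s2 ag2 I2.
have ag12 : agree [:: ie; iv; ij] [:: aA] s1 s2.
  by apply: agree_sub ag2 => x //; rewrite !inE => /orP [] ->; rewrite ?orbT.
have [R2 N2] := row_agree s2 ag12.
have hS2 : rep_rows ws s2.
  by apply: (rep_rows_agree ag12) => //; apply: (rep_rows_agree ag1) => //; exact: hS.
apply: (@tri_weaken _ _ (m * (n * (60 + 6) + 50) + 5)); last by move=> s' _; exact: id.
  apply: (@tri_for_rows ws n _ _ _ (fun j v s' => forall e x, e < m -> x < N ->
     s'.2 aA (e * N + x) =
     (x \in if e < j then row ws e else if e == j then v else [::]))) => //.
  - by move=> e x em xN; rewrite I2 //; case: eqP.
  - move=> j v w s3 jm ag3 re I3 se ew.
    have R3 e : e < m -> s3.2 aROW e = e * N by move=> em; frame; rewrite R1.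
    have wj : w < N by apply: (wN j jm); rewrite re mem_cat mem_rcons inE eqxx.
    apply: tri_put => //= e x em xN; rewrite se ew R3 // divmod_uniq //.
    have := I3 e x em xN; have [->|ne] /= := eqVneq e j.
      by rewrite ltnn ?eqxx mem_rcons inE => ->; case: eqP.
    by [].
  - move=> j s3 jm I3 e x em xN; rewrite I3 // [e < j.+1]ltnS [e <= j]leq_eqVlt.
    have [->|ne] /= := eqVneq e j; first by rewrite ?ltnn ?if_same.
    by rewrite if_same.
  - move=> s3 ag3 I3; split.
    + by frame; rewrite /=; frame.
    + by frame.
    + by move=> e v em vN; frame; rewrite R1 // I3 // em.
rewrite /U; nia.
Qed.

(** * Incidences and output *)

Definition row_incs mm e N : seq (nat * nat) := [seq (e, v) | v <- iota 0 N & mm e v].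
Definition incs m N mm : seq (nat * nat) := flatten [seq row_incs mm e N | e <- iota 0 m].

Lemma row_incsS mm e N :
  row_incs mm e N.+1 = row_incs mm e N ++ (if mm e N then [:: (e, N)] else [::]).
Proof.
by rewrite /row_incs -[N.+1]addn1 iotaD filter_cat map_cat /=; case: (mm e N).
Qed.

Lemma incsS m N mm : incs m.+1 N mm = incs m N mm ++ row_incs mm m N.
Proof. by rewrite /incs -[m.+1]addn1 iotaD map_cat flatten_cat /= cats0. Qed.

Lemma mem_incs m N mm e v :
  ((e, v) \in incs m N mm) = [&& e < m, v < N & mm e v].
Proof.
elim: m => [//|m IH]; rewrite incsS mem_cat IH /row_incs.
have -> : ((e, v) \in [seq (m, w) | w <- iota 0 N & mm m w]) = (e == m) && (v < N) && mm e v.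
  apply/mapP/andP => [[w]|[/andP [/eqP -> vN] mv]].
    by rewrite mem_filter mem_iota => /andP [mw wN] [-> ->]; rewrite eqxx.
  by exists v; rewrite ?mem_filter ?mv ?mem_iota.
by rewrite [e < m.+1]ltnS [e <= m]leq_eqVlt; have [->|_] /= := eqVneq e m; rewrite ?ltnn ?orbF.
Qed.

Lemma size_incs m N mm : size (incs m N mm) = \sum_(v < N) \sum_(e < m) mm e v.
Proof.
rewrite exchange_big /=; elim: m => [|m IH]; first by rewrite big_ord0.
rewrite incsS size_cat IH big_ord_recr /=; congr (_ + _).
by rewrite /row_incs size_map -[RHS]/(nverts N (mm m)) nvertsE.
Qed.

Definition rep_incs (L : seq (nat * nat)) (s : state) : Prop :=
  s.1 rI = size L /\ forall j, j < size L ->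
    s.2 aIE j = (nth (0, 0) L j).1 /\ s.2 aIV j = (nth (0, 0) L j).2.

(** Every pair is written, but the index advances only past true incidences, so the others are
    overwritten or lie beyond the list. *)
Definition incidences : hcmd :=
  HSeq (HSet rI (EC 0))
   (HFor ie (EV rm) (HFor iv (EV rN)
     (HSeq (HPut aIV (EV rI) (EV iv))
     (HSeq (HPut aIE (EV rI) (EV ie))
           (HSet rI (EAdd (EV rI) (EEnt (EV ie) (EV iv)))))))).

Lemma tri_incidences m N mm s (Q : state -> Prop) : prep m N mm s ->
  (forall s', agree (written incidences) (awritten incidences) s s' ->
     rep_incs (incs m N mm) s' -> Q s') ->
  tri incidences s (200 * ((m + 1) * (N + 1))) Q.
Proof.
move=> pr hQ; apply: (tri_weaken _ (leqnn _) hQ); have [sm sN _] := pr.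
set U := (m + 1) * (N + 1).
tseq (10 * U) (190 * U); first by lia.
apply: tri_set; first by rewrite /= /U; lia.
apply: (tri_for (B := m) (T := N * 76 + 10) (I := fun j => rep_incs (incs j N mm))) => //=.
- by rewrite /U; nia.
- move=> j s1 jm ag I1.
  apply: (tri_for (B := N) (T := 70) (I := fun l => rep_incs (incs j N mm ++ row_incs mm j l))) => //=.
  + by frame.
  + by lia.
  + by rewrite cats0.
  + move=> l s2 lN ag2 [h1 h2]; tseq 20 50 => //; apply: tri_put => //.
    tseq 20 30 => //; apply: tri_put => //; apply: tri_set => //.
    have sj : s2.1 ie = j by frame.
    set s3 := seta _ _ _ _; have pr3 : prep m N mm s3.
      split; [by rewrite /s3 /=; frame; rewrite /=; frame|by rewrite /s3 /=; frame; rewrite /=; frame|].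
      by move=> e v em vN; rewrite /s3 /=; frame; rewrite /=; frame; case: pr => _ _; apply.
    have entE : eval (EEnt (EV ie) (EV iv)) s3 = mm j l.
      by apply: eval_ent pr3 _ _ _ _ => //=; rewrite sj.
    rewrite row_incsS catA; set L := incs j N mm ++ _ in h1 h2 *.
    split.
      transitivity (s3.1 rI + eval (EEnt (EV ie) (EV iv)) s3); first by [].
      by rewrite entE /= h1 size_cat; case: (mm j l) => //=.
    move=> x; rewrite size_cat nth_cat => xs; rewrite /s3 /= h1 sj.
    have [xl|xl] := ltnP x (size L); first by rewrite (ltn_eqF xl); exact: h2.
    have xE : x = size L by move: xs; case: (mm j l) => /=; lia.
    by move: xs; rewrite xE eqxx subnn; case: (mm j l) => //=; lia.
  + by move=> s2 _; rewrite incsS.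
Qed.

(** Multiplication by [rI] is a sum of [rI] equal terms. *)
Definition powers : hcmd :=
  HSeq (HSet rq (ESub (EV rk) (EC 2)))
 (HSeq (HSet rP (EC 1))
 (HSeq (HFor ii (EV rq) (HSet rP (ESum ij (EV rI) (EV rP))))
 (HSeq (HFill aD ii (EV rq) (EC 0)) (HSet rfound (EC 0))))).

Lemma tri_powers k b s (Q : state -> Prop) : s.1 rk = k -> s.1 rI = b ->
  (forall s', agree (written powers) (awritten powers) s s' ->
    [/\ s'.1 rq = k - 2, s'.1 rP = b ^ (k - 2), s'.1 rfound = 0 &
       forall i, i < k - 2 -> s'.2 aD i = 0] -> Q s') ->
  tri powers s (100 * ((k - 2) * (b + 1) + 1)) Q.
Proof.
move=> sk sI hQ; apply: (tri_weaken _ (leqnn _) hQ).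
set U := (k - 2) * (b + 1).
tseq 10 (90 * (U + 1)); first by lia.
apply: tri_set => //; rewrite [eval _ _]/= sk.
tseq 10 (80 * (U + 1)); first by lia.
apply: tri_set => //; set s1 := setr _ _ _.
tseq (30 * (U + 1)) (50 * (U + 1)); first by lia.
apply: (tri_for (B := k - 2) (T := b * 9 + 14) (I := fun j s' => s'.1 rP = b ^ j)) => //.
- by rewrite /= /U; nia.
- move=> j s2 jq ag h2; apply: tri_set.
    by rewrite /=; frame; rewrite /s1 /= sI !sum_nat_const !card_ord; lia.
  by rewrite /=; frame; rewrite /s1 /= sI h2 sum_nat_const card_ord expnS.
move=> s2 ag2 P2; tseq (40 * (U + 1)) (10 * (U + 1)); first by lia.
apply: (tri_fill (c := 1) (B := k - 2) (f := fun=> 0)) => //.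
- by rewrite /=; frame.
- by rewrite /= /U; nia.
move=> s3 ag3 D3; apply: tri_set; first by rewrite /=; lia.
split=> //=; first by frame.
- by frame.
- by move=> i iq; rewrite D3 iq.
Qed.

(* The j-th output vertex goes to slot j of the array if j < 62 and to slot     *)
(* j + 1 otherwise, slot 62 holding the size: finally the cells 2-63 and 1 are  *)
(* overwritten in this order, the cells 0 and 1 serving as pointer and stride.   *)
Definition emit : hcmd :=
  HIf (EC 0) (EV rfound)
   (HSeq (HSet rz (EC 0))
   (HSeq (HFor iv (EV rN)
      (HSeq (HPut aOUT (EAdd (EV rz) (ELt (EC 61) (EV rz))) (EV iv))
            (HSet rz (EAdd (EV rz) (EGet aB (EV iv))))))
         (HPut aOUT (EC 62) (EV rz)))) HSkip.

Lemma tri_emit N t (s : state) (Q : state -> Prop) : s.1 rN = N ->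
  (s.1 rfound = 1 -> forall v, v < N -> s.2 aB v = t v) ->
  (forall s', agree (written emit) (awritten emit) s s' ->
    (s.1 rfound = 1 -> let L := [seq v <- iota 0 N | t v] in
      [/\ s'.1 rz = size L, s'.2 aOUT 62 = size L &
        forall j, j < size L -> s'.2 aOUT (j + (61 < j)) = nth 0 L j]) -> Q s') ->
  s.1 rfound = 0 \/ s.1 rfound = 1 ->
  tri emit s (100 * (N + 1)) Q.
Proof.
move=> sN hB hQ hf; apply: (tri_weaken _ (leqnn _) hQ).
apply: (tri_if (T1 := 90 * (N + 1))) => /=; first by lia.
- move=> f0; have {hf} f1 : s.1 rfound = 1 by case: hf; lia.
  tseq 10 (80 * (N + 1)); first by lia.
  apply: tri_set => //.
  tseq (60 * (N + 1)) 20; first by lia.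
  pose I L (s' : state) := s'.1 rz = size L /\
    forall j, j < size L -> s'.2 aOUT (j + (61 < j)) = nth 0 L j.
  apply: (tri_for (B := N) (T := 54) (I := fun j => I [seq v <- iota 0 j | t v])) => //.
  + by rewrite /=; lia.
  + move=> j s1 jN ag [h1 h2]; tseq 30 24 => //; apply: tri_put => //; apply: tri_set => //.
    rewrite -[j.+1]addn1 iotaD filter_cat add0n /I /=.
    have -> : s1.2 aB j = t j by frame; rewrite /= hB.
    set L := [seq v <- iota 0 j | t v] in h1 h2 *.
    rewrite h1 size_cat; split; first by rewrite /=; case: (t j).
    move=> i; rewrite nth_cat => il.
    have lE : 1 - (1 - (size L - 61)) = (61 < size L) by lia.
    rewrite lE; have [iL|iL] := ltnP i (size L).
      rewrite ifN ?h2 //; apply/eqP; by lia.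
    have iE : i = size L by move: il; case: (t j) => /=; lia.
    by move: il; rewrite iE eqxx subnn; case: (t j) => //=; lia.
  + move=> s1 ag [h1 h2]; apply: tri_put => //= _; rewrite h1; split=> // j jL.
    rewrite ifN ?h2 //; apply/eqP; lia.
- move=> f0; apply: tri_set; first by rewrite /=; lia.
  by move=> f1; lia.
Qed.

(** * The decision procedure *)

(** Used to pass between the computed bound N and the true n: the vertices in between lie in no
    edge. *)
Lemma filter_widen N n t : N <= n -> (forall v, v < n -> t v -> v < N) ->
  [seq v <- iota 0 N | t v] = [seq v <- iota 0 n | t v].
Proof.
move=> Nn h; rewrite -(subnKC Nn) iotaD filter_cat add0n.
rewrite (_ : [seq v <- iota N _ | t v] = [::]) ?cats0 //.
apply/eqP; rewrite -(negbK (_ == _)) -has_filter; apply/hasP => -[v].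
by rewrite mem_iota subnKC // => /andP [Nv vn] /(h v vn); rewrite ltnNge Nv.
Qed.

Lemma nverts_widen N n t : N <= n -> (forall v, v < n -> t v -> v < N) ->
  nverts N t = nverts n t.
Proof. by move=> Nn h; rewrite !nvertsE (filter_widen Nn h). Qed.

Lemma cnt_widen N n mm t e : N <= n -> (forall v, mm e v -> v < N) ->
  cnt N mm t e = cnt n mm t e.
Proof.
move=> Nn h; apply: (nverts_widen (t := fun v => t v && mm e v) Nn) => v _ /andP [_].
exact: h.
Qed.

Definition main : hcmd :=
  HSeq span (HSeq matrix (HSeq incidences (HSeq powers (HSeq search emit)))).
Definition decide_rank : hcmd :=
  HSeq offsets (HIf (EC 0) (EV rbad) (HSet rfound (EC 0)) main).

Lemma fits_decide_rank : fits decide_rank 33.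
Proof. by []. Qed.

Lemma tri_decide_rank_empty_row ws m n s (Q : state -> Prop) :
  all (fun w => 0 < size w) ws -> size ws < m -> s.1 rm = m -> rep_stream ws s ->
  0 < n -> (forall s', s'.1 rfound = 0 -> Q s') ->
  tri decide_rank s (1000 * (m * n)) Q.
Proof.
move=> ne fm sm hS n0 hQ; have mmn : m <= m * n by rewrite leq_pmulr.
have m0 : 0 < m by lia.
tseq (400 * (m * n)) (600 * (m * n)); first by lia.
apply: (@tri_weaken _ _ (200 * (m + 1))); last by move=> s' _; exact: id.
  apply: (tri_offsets ne (ltnW fm) sm hS) => s1 _ [_ bad].
  apply: (tri_if (T1 := 10)) => /=; first by lia.
    by move=> _; apply: tri_set => //; exact: hQ.
  by rewrite leqn0 => /eqP b0; move: bad; rewrite b0 fm.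
by lia.
Qed.

(** The search dominates: reading the hypergraph is O(mn), and computing the number of tuples costs
    no more than a multiple of that number. *)
Lemma tri_main (ws : seq (seq nat)) n k (s : state) (Q : state -> Prop) :
  let m := size ws in let mm (e v : nat) := v \in row ws e in
  let b := \sum_(v < n) \sum_(e < m) mm e v in
  all (fun w => 0 < size w) ws -> 0 < m -> k <= m ->
  small_rows n ws -> rep_rows ws s -> s.1 rk = k ->
  (forall s',
     (s'.1 rfound = 0 /\ ~ exists t, [/\ hits n m mm t, critical n m mm t & k <= nverts n t]) \/
     (s'.1 rfound = 1 /\ exists t, [/\ hits n m mm t, critical n m mm t, k <= nverts n t &
        let L := [seq v <- iota 0 n | t v] in
        [/\ s'.1 rz = size L, s'.2 aOUT 62 = size L &
          forall j, j < size L -> s'.2 aOUT (j + (61 < j)) = nth 0 L j]]) -> Q s') ->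
  tri main s (4000 * (b ^ (k - 2) * (10 * (m * n)))) Q.
Proof.
move=> m mm b /(all_nthP [::]) ne m0 km sm hS sk hQ.
have n0 : 0 < n.
  have [h _] := sm 0; apply: leq_trans h; exact: ne.
set U := 10 * (m * n); have U0 : 0 < U by rewrite !muln_gt0 m0.
have Un : n + 1 <= U by rewrite /U; nia.
(* Every edge is nonempty and so contributes an incidence. *)
have mb : m <= b.
  rewrite /b exchange_big /= -[X in X <= _]card_ord -sum1_card; apply: leq_sum => e _.
  have we := ne e (ltn_ord e); have [_ h] := sm e.
  have w0 : nth 0 (row ws e) 0 \in row ws e by exact: mem_nth.
  by rewrite (bigD1 (Ordinal (h _ w0))) //= /mm w0.
have b0 : 0 < b by lia.
set B := b ^ (k - 2); have B0 : 0 < B by rewrite expn_gt0 b0.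
have UB : U <= B * U by rewrite leq_pmull.
(* For q = k - 2 > 0 one has b >= m >= k > 2, and q <= 2^(q-1) <= b^(q-1) gives q b <= b^q. *)
have qb : (k - 2) * (b + 1) <= 2 * B.
  have [->|q0] := posnP (k - 2); first by [].
  have b2 : 2 <= b by lia.
  have : (k - 2) <= b ^ (k - 2).-1.
    apply: leq_trans (_ : 2 ^ (k - 2).-1 <= _); last by case: (_.-1) => // e; rewrite leq_exp2r.
    by rewrite -{1}(prednK q0) ltn_expl.
  have -> : B = b * b ^ (k - 2).-1 by rewrite /B -expnS prednK.
  move=> h.
  have : (k - 2) * b <= b * b ^ (k - 2).-1 by rewrite mulnC leq_mul2l h orbT.
  have : b ^ (k - 2).-1 <= b * b ^ (k - 2).-1 by rewrite leq_pmull.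
  by lia.
have BU : B <= B * U by rewrite leq_pmulr.
have mn1 : m * (n + 1) + 1 <= U by rewrite /U; nia.
have mN1 N : N <= n -> (m + 1) * (N + 1) <= U.
  move=> Nn; apply: leq_trans (_ : (m + 1) * (n + 1) <= _); first by rewrite leq_mul2l; lia.
  by rewrite /U; nia.
clearbody U.
tseq (100 * U) (3900 * (B * U)); first by lia.
apply: (@tri_weaken _ _ (100 * (m * (n + 1) + 1))); [|by lia|by move=> s' _; exact: id].
apply: (tri_span hS sm) => s1 ag1; set N := s1.1 rN => -[Nn wN].
have hS1 : rep_rows ws s1 by exact: rep_rows_agree ag1 isT hS.
have mmN e v : mm e v -> v < N.
  have [em|me] := ltnP e m; first exact: wN.
  by rewrite /mm nth_default.
have {}mN1 := mN1 _ Nn.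
tseq (300 * U) (3600 * (B * U)); first by lia.
apply: (@tri_weaken _ _ (300 * (m * (n + 1) + 1))); [|by lia|by move=> s' _; exact: id].
apply: (tri_matrix hS1 sm (erefl _) Nn wN) => s2 ag2 pr2.
tseq (200 * U) (3400 * (B * U)); first by lia.
apply: (@tri_weaken _ _ (200 * ((m + 1) * (N + 1)))); [|by lia|by move=> s' _; exact: id].
apply: (tri_incidences pr2) => s3 ag3 [I3 E3].
have bE : size (incs m N mm) = b.
  rewrite size_incs /b exchange_big [RHS]exchange_big /=.
  apply: eq_bigr => e _; exact: (nverts_widen Nn (fun v _ => @mmN e v)).
have pr3 := prep_agree ag3 isT pr2.
have sk3 : s3.1 rk = k by frame.
rewrite [size _]bE in I3 E3.
tseq (300 * B) (3000 * (B * U)); first by lia.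
apply: (@tri_weaken _ _ (100 * ((k - 2) * (b + 1) + 1))); [|by lia|by move=> s' _; exact: id].
apply: (tri_powers sk3 I3) => s4 ag4 [q4 P4 f4 D4].
have pr4 := prep_agree ag4 isT pr3.
tseq (2300 * (B * U)) (200 * (B * U)); first by lia.
have cB : B * (2200 * ((m + 1) * (N + 1))) + 5 <= 2300 * (B * U).
  have : B * (2200 * ((m + 1) * (N + 1))) <= B * (2200 * U) by rewrite leq_mul2l; lia.
  by lia.
apply: tri_weaken (cB) (fun _ _ h => h).
apply: (tri_search (k := k) (iV := fun j => (nth (0, 0) (incs m N mm) j).2)
   (iE := fun j => (nth (0, 0) (incs m N mm) j).1) pr4) => //.
- by frame.
- by lia.
- by frame.
- move=> j jb; have [e1 e2] := E3 j jb; frame; rewrite e1 e2; split=> //.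
  have : nth (0, 0) (incs m N mm) j \in incs m N mm by rewrite mem_nth ?bE.
  by case: (nth _ _ _) => e v; rewrite mem_incs => /and3P [].
move=> s5 ag5; cbv zeta => F5.
have sN5 : s5.1 rN = N by frame.
have f5 : s5.1 rfound = 0 \/ s5.1 rfound = 1 by case: F5 => [[? _]|[? _]]; [left|right].
have cnE t e : cnt N mm t e = cnt n mm t e by apply: cnt_widen Nn _ => v; exact: mmN.
have cN : 100 * (N + 1) <= 200 * (B * U) by lia.
apply: (@tri_weaken _ _ (100 * (N + 1))); [|exact: cN|by move=> s' _; exact: id].
case: F5 => [[f0 no]|[f1 [vs [es [su B5]]]]].
- apply: (tri_emit (t := fun=> false) sN5) => //; first by rewrite f0.
  move=> s6 ag6 _; apply: hQ; left; split; first by frame.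
  move=> [t [ht ct kt]].
  have tN v : v < n -> t v -> v < N.
    by move=> vn tv; have [e em /andP [mv _]] := ct v vn tv; exact: mmN mv.
  have htN : hits N m mm t by move=> e em; rewrite cnE; exact: ht.
  have ctN : critical N m mm t.
    by move=> v vN tv; have [e em h] := ct v (leq_trans vN Nn) tv; exists e => //; rewrite cnE.
  have ktN : k <= nverts N t by rewrite (nverts_widen Nn tN).
  have [vs [es [h1 h2 h3]]] := extend_complete htN ctN ktN.
  (* The tuple supplied by completeness is located in the list of incidences, and its positions are
     the digits of a counter value already tested. *)
  pose d i := index (es i, vs i) (incs m N mm).
  have dIn i : i < k - 2 -> (es i, vs i) \in incs m N mm.
    by move=> iq; have [a1 a2 a3] := h1 i iq; rewrite mem_incs a2 a1.
  have [|x xB dx] := @digit_surj b (k - 2) d.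
    by move=> i iq; rewrite -bE index_mem; exact: dIn.
  have := no x xB; rewrite (@success_ext N m mm k _ _ vs es).
  + by rewrite /success h3 andbT => /negP; apply; apply/forallP => e; exact: h2.
  + by move=> i iq; rewrite dx // nth_index ?dIn.
  + by move=> i iq; rewrite dx // nth_index ?dIn.
- set t := greedy _ _ _ _ _ in B5.
  (* Beyond N the predicate [t] is arbitrary, so it is cut off there. *)
  pose t' v := t v && (v < N).
  have [hg cg kg] := success_sound su.
  have tt' v : v < N -> t' v = t v by rewrite /t' => ->; rewrite andbT.
  have cE e : cnt n mm t' e = cnt N mm t e.
    by rewrite -cnE; apply: eq_bigr => v _; rewrite tt'.
  have t'N v : v < n -> t' v -> v < N by rewrite /t' => _ /andP [].
  apply: (tri_emit (t := t') sN5) => //; first by move=> _ v vN; rewrite B5 // tt'.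
  move=> s6 ag6 /(_ f1); rewrite (filter_widen Nn t'N) => out.
  apply: hQ; right; split; first by frame.
  exists t'; split=> //.
  + by move=> e em; rewrite cE; exact: hg.
  + move=> v vn /andP [tv vN]; have [e em h] := cg v vN tv.
    by exists e => //; rewrite cE.
  + rewrite -(nverts_widen Nn t'N); apply: leq_trans kg _.
    by apply: leq_sum => v _; rewrite tt'.
Qed.

(** * Relocating the input *)

Definition copy_loop : cmd :=
  CWhile 4 5 (CLoad 6 0 ;; CStore 3 6 ;; CAdd 0 0 1 ;; CAdd 3 3 2 ;; CAdd 4 4 9).

(** [a] and [c] are the strides of source and target; since the two are disjoint, the order of
    copying does not matter. *)
Lemma runs_copy_loop src dst a c lo hi M (Q : memory -> Prop) :
  M 0 = src -> M 1 = a -> M 2 = c -> M 3 = dst -> M 4 = lo -> M 5 = hi -> M 9 = 1 ->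
  0 < c -> 64 <= src -> 64 <= dst ->
  (forall i j, i < hi - lo -> j < hi - lo -> src + a * i <> dst + c * j) ->
  (forall M', (forall i, i < hi - lo -> M' (dst + c * i) = M (src + a * i)) ->
     (forall x, x \notin [:: 0; 3; 4; 6] ->
        (forall i, i < hi - lo -> x <> dst + c * i) -> M' x = M x) -> Q M') ->
  runs copy_loop M ((hi - lo) * 7 + 2) Q.
Proof.
move=> h0 h1 h2 h3 h4 h5 h9 c0 s64 d64 dis hQ.
pose J i M' := [/\ M' 0 = src + a * i, M' 3 = dst + c * i, M' 4 = lo + i,
  forall l, l < i -> M' (dst + c * l) = M (src + a * l) &
  forall x, x \notin [:: 0; 3; 4; 6] -> (forall l, l < i -> x <> dst + c * l) -> M' x = M x].
have -> : (hi - lo) * 7 = \sum_(i < hi - lo) (5 + 2) by rewrite sum_nat_const card_ord.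
apply: (runs_while (J := J) (B := hi - lo) (f := fun=> 5)).
- by rewrite /J !muln0 !addn0; split.
- move=> i M' lt [j0 j3 j4 jd jx].
  have o x : 9 < x -> x \notin [:: 0; 3; 4; 6] by rewrite !inE; lia.
  have r x : x \notin [:: 0; 3; 4; 6] -> x < 64 -> M' x = M x.
    by move=> xn x64; apply: jx => // l _; lia.
  split; first by rewrite j4 r // h5; lia.
  apply: (@runs_weaken _ _ (1 + (1 + (1 + (1 + 1)))) _ (J i.+1)) => //; urun.
  rewrite j0 [upd _ 6 _ 3]upd_neq // j3 upd_eq.
  have e1 : M' 1 = a by rewrite r.
  have e2 : M' 2 = c by rewrite r.
  have e9 : M' 9 = 1 by rewrite r.
  have es : M' (src + a * i) = M (src + a * i).
    apply: jx; first by apply: o; lia.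
    by move=> l li; apply: dis => //; lia.
  split; mem; rewrite ?j0 ?j3 ?j4 ?e1 ?e2 ?e9; try nia.
  + move=> l; rewrite ltnS leq_eqVlt => /orP [/eqP ->|li]; mem; first exact: es.
    have ltc : c * l < c * i by rewrite ltn_mul2l c0.
    by rewrite upd_neq; [mem; exact: jd|apply/eqP; lia].
  + move=> x; rewrite !inE !negb_or => /and4P [x0 x3 x4 x6] hx; mem.
    rewrite upd_neq; last by apply/eqP; exact: hx.
    rewrite upd_neq // jx // ?inE ?negb_or ?x0 ?x3 ?x4 // => l li; apply: hx; lia.
- move=> M' [j0 j3 j4 jd jx]; split; last by apply: hQ.
  by rewrite j4 jx // ?h5; [lia|move=> l _; lia].
Qed.

(** Unrolled, because the cells moved are named in the instructions and no spare cell is left for a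
    second pointer. *)
Fixpoint spill (x n : nat) : cmd :=
  if n is n'.+1 then CStore 0 x ;; CAdd 0 0 1 ;; spill x.+1 n' else CSkip.
Fixpoint fetch (x n : nat) : cmd :=
  if n is n'.+1 then CLoad x 0 ;; CAdd 0 0 1 ;; fetch x.+1 n' else CSkip.

Lemma runs_spill x n d M (Q : memory -> Prop) : M 0 = d -> M 1 = 16 -> 1 < x -> x + n <= d ->
  (forall M', M' 0 = d + 16 * n -> (forall i, i < n -> M' (d + 16 * i) = M (x + i)) ->
     (forall y, y <> 0 -> (forall i, i < n -> y <> d + 16 * i) -> M' y = M y) -> Q M') ->
  runs (spill x n) M (2 * n) Q.
Proof.
elim: n x d M Q => [|n IH] x d M Q h0 h1 x1 xd hQ.
  by apply: runs_skip; apply: hQ; rewrite ?h0 ?addn0.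
have -> : 2 * n.+1 = 1 + (1 + 2 * n) by lia.
urun; apply: (IH x.+1 (d + 16)); try (by mem; rewrite ?h0 ?h1); try lia.
move=> M' e0 es eo; apply: hQ.
- by rewrite e0; lia.
- case=> [_|i lin].
    rewrite muln0 !addn0 eo; [by mem; rewrite h0 upd_eq|lia|move=> i _; lia].
  have -> : d + 16 * i.+1 = d + 16 + 16 * i by lia.
  by rewrite es // -addSnnS; mem.
- move=> y y0 hy; rewrite eo //; last by move=> i lin e; apply: (hy i.+1); lia.
  by rewrite upd_neq ?upd_neq //; apply/eqP => //; rewrite h0 => e; apply: (hy 0); lia.
Qed.

Lemma runs_fetch x n d M (Q : memory -> Prop) : M 0 = d -> M 1 = 16 -> 1 < x -> x + n <= d ->
  (forall M', M' 0 = d + 16 * n -> (forall i, i < n -> M' (x + i) = M (d + 16 * i)) ->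
     (forall y, y <> 0 -> (forall i, i < n -> y <> x + i) -> M' y = M y) -> Q M') ->
  runs (fetch x n) M (2 * n) Q.
Proof.
elim: n x d M Q => [|n IH] x d M Q h0 h1 x1 xd hQ.
  by apply: runs_skip; apply: hQ; rewrite ?h0 ?addn0.
have -> : 2 * n.+1 = 1 + (1 + 2 * n) by lia.
urun; apply: (IH x.+1 (d + 16)); try (by mem; rewrite ?h0 ?h1); try lia.
move=> M' e0 es eo; apply: hQ.
- by rewrite e0; lia.
- case=> [_|i lin].
    by rewrite muln0 !addn0 eo; [mem; rewrite h0|lia|move=> i _; lia].
  rewrite -addSnnS es //; mem; congr (M _); lia.
- move=> y y0 hy; rewrite eo //; last by move=> i lin e; apply: (hy i.+1); lia.
  by rewrite upd_neq ?upd_neq //; apply/eqP => // e; apply: (hy 0); lia.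
Qed.

Definition tri_num m : nat := \sum_(i < m.+1) i.

Lemma tri_num0 : tri_num 0 = 0.
Proof. by rewrite /tri_num big_ord_recl big_ord0. Qed.

Lemma tri_numS m : tri_num m.+1 = tri_num m + m.+1.
Proof. by rewrite /tri_num big_ord_recr. Qed.

Lemma tri_num_mono i j : i <= j -> tri_num i <= tri_num j.
Proof.
elim: j => [|j IH]; first by rewrite leqn0 => /eqP ->.
rewrite leq_eqVlt => /orP [/eqP -> //|ij]; rewrite tri_numS; have := IH ij; lia.
Qed.

(** Adds m, m - 1, ..., 1 to k using only the cells 0, 1 and 2. *)
Definition pack : cmd :=
  CConst 0 1 ;; CWhile 0 2 (CAdd 1 1 2 ;; CSub 2 2 0) ;; CAdd 1 1 2.

Lemma runs_pack k m M (Q : memory -> Prop) : 0 < m -> M 1 = k -> M 2 = m ->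
  (forall M', M' 1 = tri_num m + k -> (forall x, 2 < x -> M' x = M x) -> Q M') ->
  runs pack M (4 * m) Q.
Proof.
move=> m0 h1 h2 hQ.
pose J i M' := [/\ M' 0 = 1, M' 1 + tri_num (m - i) = tri_num m + k, M' 2 = m - i &
  forall x, 2 < x -> M' x = M x].
apply: (@runs_weaken _ _ (1 + ((\sum_(i < m.-1) (2 + 2) + 2) + 1)) _ Q) => //; last first.
  by rewrite sum_nat_const card_ord; lia.
urun; apply: (runs_while (J := J) (B := m.-1) (f := fun=> 2)).
- by split; try (by mem; rewrite ?subn0; lia); move=> x x2; mem.
- move=> i M' im [j0 j1 j2 jx]; split; first by rewrite j0 j2; lia.
  apply: (@runs_weaken _ _ (1 + 1) _ (J i.+1)) => //; urun.
  split; mem; rewrite ?j0 ?j2 //; try lia.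
  + by have := tri_numS (m - i.+1); rewrite -subSn ?subSS; lia.
  + by move=> x x2; mem; exact: jx.
- move=> M' [j0 j1 j2 jx]; have e1 : m - m.-1 = 1 by lia.
  rewrite e1 in j1 j2; split; first by rewrite j0 j2.
  urun; apply: hQ => [|x x2]; mem; last exact: jx.
  by move: j1; rewrite j2 tri_numS tri_num0.
Qed.

Definition unpack : cmd :=
  CConst 3 1 ;; CConst 2 0 ;; CWhile 2 1 (CAdd 2 2 3 ;; CSub 1 1 2).

(** Subtracting 1, 2, 3, ... stops exactly at m: before that the remainder exceeds the counter, and
    after m rounds it is k <= m. *)
Lemma runs_unpack k m M (Q : memory -> Prop) : k <= m -> M 1 = tri_num m + k ->
  (forall M', M' 1 = k -> M' 2 = m -> (forall x, 3 < x -> M' x = M x) -> Q M') ->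
  runs unpack M (4 * m + 4) Q.
Proof.
move=> km h1 hQ.
pose J i M' := [/\ M' 3 = 1, M' 1 + tri_num i = tri_num m + k, M' 2 = i &
  forall x, 3 < x -> M' x = M x].
apply: (@runs_weaken _ _ (1 + (1 + (\sum_(i < m) (2 + 2) + 2))) _ Q) => //; last first.
  by rewrite sum_nat_const card_ord; lia.
urun; apply: (runs_while (J := J) (B := m) (f := fun=> 2)).
- split; try (by mem; rewrite ?h1 ?tri_num0 ?addn0).
  by move=> x x2; mem.
- move=> i M' im [j0 j1 j2 jx].
  have := tri_num_mono im; have := tri_numS i => e1 e2.
  split; first by rewrite j2; lia.
  apply: (@runs_weaken _ _ (1 + 1) _ (J i.+1)) => //; urun.
  split; mem; rewrite ?j0 ?j2 //; try lia.
  by move=> x x2; mem; exact: jx.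
- move=> M' [j0 j1 j2 jx]; split; first by rewrite j2; lia.
  by apply: hQ => //; lia.
Qed.

(** Cell 2 holds the pointer plus the size it points to, so comparing it with the pointer tests for
    a nonzero size without a cell containing 0. *)
Definition scan : cmd :=
  CConst 0 3 ;; CLoad 2 0 ;; CAdd 2 2 0 ;;
  CWhile 0 2 (CConst 0 1 ;; CAdd 0 0 2 ;; CLoad 2 0 ;; CAdd 2 2 0).

Lemma runs_scan ws M (Q : memory -> Prop) : all (fun w => 0 < size w) ws ->
  (forall i, i <= size (stream ws) -> M (3 + i) = nth 0 (stream ws) i) ->
  (forall M', M' 0 = 3 + size (stream ws) -> (forall x, x <> 0 -> x <> 2 -> M' x = M x) -> Q M') ->
  runs scan M (6 * size ws + 5) Q.
Proof.
move=> /(all_nthP [::]) ne hS hQ.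
pose J i M' := [/\ M' 0 = 3 + offset ws i, M' 2 = M' 0 + M (M' 0) &
  forall x, x <> 0 -> x <> 2 -> M' x = M x].
apply: (@runs_weaken _ _ (1 + (1 + (1 + (\sum_(i < size ws) (4 + 2) + 2)))) _ Q) => //; last first.
  by rewrite sum_nat_const card_ord; lia.
urun; apply: (runs_while (J := J) (B := size ws) (f := fun=> 4)).
- split; [by mem; rewrite offset0|by mem; lia|by move=> x x0 x2; mem].
- move=> i M' im [j0 j2 jx].
  have ei : M (3 + offset ws i) = size (row ws i).
    by rewrite hS ?stream_size // offset_le // ltnW.
  have ne_i := ne i im; rewrite j0 ei in j2.
  split; first by rewrite j0 j2; lia.
  apply: (@runs_weaken _ _ (1 + (1 + (1 + 1))) _ (J i.+1)) => //; urun.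
  split; mem; rewrite ?j2.
  + by rewrite offsetS //; lia.
  + by rewrite jx; lia.
  + by move=> x x0 x2; mem; exact: jx.
- move=> M' [j0 j2 jx]; rewrite offset_size in j0.
  have e : M (M' 0) = 0 by rewrite j0 hS // nth_default.
  by split; [rewrite j2 e; lia|apply: hQ].
Qed.

Lemma runs_add_eq d a b M x y (Q : memory -> Prop) :
  M a = x -> M b = y -> Q (upd M d (x + y)) -> runs (CAdd d a b) M 1 Q.
Proof. by move=> <- <-; exact: runs_add. Qed.

Lemma runs_sub_eq d a b M x y (Q : memory -> Prop) :
  M a = x -> M b = y -> Q (upd M d (x - y)) -> runs (CSub d a b) M 1 Q.
Proof. by move=> <- <-; exact: runs_sub. Qed.

Lemma runs_load_eq d a M x y (Q : memory -> Prop) :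
  M a = x -> M x = y -> Q (upd M d y) -> runs (CLoad d a) M 1 Q.
Proof. by move=> <- <-; exact: runs_load. Qed.

Lemma runs_store_eq a b M x y (Q : memory -> Prop) :
  M a = x -> M b = y -> Q (upd M x y) -> runs (CStore a b) M 1 Q.
Proof. by move=> <- <-; exact: runs_store. Qed.

Ltac rstep := first
  [ apply: runs_seq | apply: runs_const
  | apply: runs_add_eq; [by mem | by mem | ]
  | apply: runs_sub_eq; [by mem | by mem | ]
  | apply: runs_load_eq; [by mem | by mem | ]
  | apply: runs_store_eq; [by mem | by mem | ] ].

(* Spills the cells 3-63 as the first slots of array 0, then copies the rest of *)
(* the stream; the packed pair (k, m) waits in slot 0 of array 1.               *)
Definition relocate : cmd :=
  CConst 2 64 ;; CAdd 0 0 2 ;; CConst 2 1 ;; CAdd 0 0 2 ;; CStore 0 1 ;;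
  CSub 0 0 2 ;; CConst 1 16 ;; spill 3 61 ;;
  CConst 3 976 ;; CSub 32 0 3 ;;
  CConst 2 16 ;; CConst 9 1 ;; CConst 1 1 ;;
  CConst 4 64 ;; CSub 5 32 4 ;; CAdd 5 5 9 ;;
  CAdd 3 32 3 ;; CConst 0 64 ;; copy_loop ;;
  CConst 3 1 ;; CAdd 3 32 3 ;; CLoad 1 3.

Lemma runs_relocate ws M (Q : memory -> Prop) : M 0 = 3 + size (stream ws) ->
  (forall i, i <= size (stream ws) -> M (3 + i) = nth 0 (stream ws) i) ->
  (forall M', M' 32 = 67 + size (stream ws) -> M' 1 = M 1 ->
     (forall i, i <= size (stream ws) -> M' (67 + size (stream ws) + 16 * i) = nth 0 (stream ws) i) -> Q M') ->
  runs relocate M (7 * size (stream ws) + 200) Q.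
Proof.
move=> h0 hS hQ; set len := size (stream ws) in h0 hS hQ *.
apply: (@runs_weaken _ _ (1 + (1 + (1 + (1 + (1 + (1 + (1 + (2 * 61 + (1 + (1 + (1 + (1 + (1 +
  (1 + (1 + (1 + (1 + (1 + ((len + 4 - 64) * 7 + 2 + (1 + (1 + 1))))))))))))))))))))) _ Q) => //; last by lia.
have b0 : M 0 + 64 = 67 + len by lia.
do 14!rstep; apply: runs_seq.
set M1 := upd _ _ _.
have M1x x : 2 < x -> x <> 68 + len -> M1 x = M x by move=> *; rewrite /M1; mem.
have M1X : M1 (68 + len) = M 1 by rewrite /M1; mem; rewrite (_ : 68 + len = M 0 + 64 + 1) ?upd_eq; lia.
apply: (@runs_spill _ _ (67 + len)); rewrite ?/M1; try (by mem; lia); try lia.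
rewrite -/M1 => M2 z0 zs zo; do 21!rstep.
set M3 := upd _ _ _.
have M3x x : 63 < x -> M3 x = M2 x by move=> *; rewrite /M3; mem.
(* 976 = 16 * 61 skips the slots filled by [spill]; the upper end [len + 4] includes the terminating
   zero in cell [3 + len]. *)
have hiE : 67 + len + 976 - 976 - 64 + 1 = len + 4 by lia.
apply: (@runs_copy_loop 64 (67 + len + 976) 1 16 64 (len + 4)); rewrite ?/M3;
  try (by mem; lia); try (by move=> *; lia); try lia.
rewrite -/M3 => M4 cs co.
have c32 : M4 32 = 67 + len by rewrite co; [rewrite /M3; mem; lia|by []|move=> i _; lia].
do 2!rstep.
apply: runs_seq; apply: runs_add_eq; [mem; exact: c32|by mem|].
have c68 : M4 (68 + len) = M 1.
  rewrite co; [|by rewrite !inE; lia|by move=> i _; lia].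
  by rewrite M3x; [rewrite zo; [exact: M1X|lia|move=> i _; lia]|lia].
apply: (@runs_load_eq _ _ _ (67 + len + 1) (M 1)); [by mem|by mem; rewrite -c68; congr M4; lia|].
apply: hQ => [||i il]; mem => //.
have [i61|i61] := ltnP i 61.
  rewrite co; [|by rewrite !inE; lia|by move=> j _; lia].
  by rewrite M3x ?zs ?M1x ?hS //; lia.
have -> : 67 + len + 16 * i = 67 + len + 976 + 16 * (i - 61) by lia.
rewrite cs; last by lia.
rewrite M3x; last by lia.
rewrite zo; [|by lia|by move=> j _; lia].
by rewrite M1x; [rewrite -hS //; congr M; lia|lia|lia].
Qed.

(** * Writing the output *)

Lemma tri_decide_rank (ws : seq (seq nat)) n k (s : state) (Q : state -> Prop) :
  let m := size ws in let mm (e v : nat) := v \in row ws e in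
  let b := \sum_(v < n) \sum_(e < m) mm e v in
  all (fun w => 0 < size w) ws -> 0 < m -> k <= m ->
  small_rows n ws -> s.1 rm = m -> rep_stream ws s -> s.1 rk = k ->
  (forall s',
     (s'.1 rfound = 0 /\ ~ exists t, [/\ hits n m mm t, critical n m mm t & k <= nverts n t]) \/
     (s'.1 rfound = 1 /\ exists t, [/\ hits n m mm t, critical n m mm t, k <= nverts n t &
        let L := [seq v <- iota 0 n | t v] in
        [/\ s'.1 rz = size L, s'.2 aOUT 62 = size L &
          forall j, j < size L -> s'.2 aOUT (j + (61 < j)) = nth 0 L j]]) -> Q s') ->
  tri decide_rank s (4600 * (b ^ (k - 2) * (10 * (m * n)))) Q.
Proof.
move=> m mm b ne m0 km sm sM hS sk hQ.
have n0 : 0 < n.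
  have [h _] := sm 0; apply: leq_trans h; exact: (all_nthP [::] ne).
have mn : m <= m * n by rewrite leq_pmulr.
have b0 : 0 < b.
  have we := all_nthP [::] ne _ m0; have [_ h] := sm 0.
  have w0 := mem_nth 0 we; rewrite /b (bigD1 (Ordinal (h _ w0))) //= (bigD1 (Ordinal m0)) //=.
  by rewrite /mm w0.
have {}b0 : 0 < b ^ (k - 2) by rewrite expn_gt0 b0.
have W : m * n <= b ^ (k - 2) * (m * n) by rewrite leq_pmull.
rewrite (_ : b ^ (k - 2) * (10 * (m * n)) = 10 * (b ^ (k - 2) * (m * n))); last by rewrite mulnCA.
set W' := b ^ (k - 2) * (m * n) in W *.
have WE : b ^ (k - 2) * (10 * (m * n)) = 10 * W' by rewrite mulnCA.
tseq (400 * W') (4500 * (10 * W')); first by lia.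
apply: (@tri_weaken _ _ (200 * (m + 1))); [|by lia|by move=> s' _; exact: id].
apply: (tri_offsets ne (leqnn _) sM hS) => s1 ag1 [h1 h2].
apply: (tri_if (T1 := 4400 * (10 * W'))) => /=; first by lia.
  by rewrite h2 ltnn.
move=> _; rewrite -/m.
apply: (@tri_weaken _ _ (4000 * (b ^ (k - 2) * (10 * (m * n))))); last by move=> s' _; exact: id.
  apply: tri_main => //.
  - split=> [|j jm]; first by frame.
    rewrite h1 // !(proj2 ag1) //; split; first exact: rep_stream_size.
    by move=> l lj; rewrite (proj2 ag1) //; exact: rep_stream_nth.
  - by frame.
by rewrite WE; lia.
Qed.

Definition finish : cmd :=
  CConst 0 0 ;;
  CIf 0 7
    (CConst 3 1020 ;; CAdd 0 32 3 ;; CConst 1 16 ;; CConst 2 1 ;; CConst 9 1 ;;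
     CConst 3 2 ;; CAdd 5 8 3 ;; CConst 4 64 ;; CConst 3 64 ;; copy_loop ;;
     CConst 3 12 ;; CAdd 0 32 3 ;; CConst 1 16 ;; fetch 2 62 ;;
     CLoad 1 0 ;; CConst 0 1)
    CSkip.

Lemma runs_finish_reject base s M n (Q : memory -> Prop) : stored base s M -> s.1 rfound = 0 ->
  (forall M', M' 0 = 0 -> Q M') -> runs finish M (7 * n + 200) Q.
Proof.
move=> [rb rr ra] f0 hQ.
apply: (@runs_weaken _ _ (1 + 2) _ Q) => //; last by lia.
apply: runs_seq; apply: runs_const; apply: runs_if; mem; first by rewrite rr // f0.
by move=> _; apply: (@runs_weaken _ _ 0 _ Q) => //; apply: runs_skip; apply: hQ; mem.
Qed.

Lemma runs_finish_accept base s M L n (Q : memory -> Prop) : 64 <= base ->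
  stored base s M -> s.1 rfound = 1 -> size L + 2 <= base -> size L <= n ->
  s.1 rz = size L -> s.2 aOUT 62 = size L ->
  (forall j, j < size L -> s.2 aOUT (j + (61 < j)) = nth 0 L j) ->
  (forall M', M' 0 = 1 -> output_set M' = L -> Q M') ->
  runs finish M (7 * n + 200) Q.
Proof.
move=> b64 [rb rr ra] f1 Lb Ln zL oL oj hQ.
have hL : M 8 = size L by rewrite rr.
apply: (@runs_weaken _ _ (1 + (1 + (1 + (1 + (1 + (1 + (1 + (1 + (1 + (1 + ((size L + 2 - 64) * 7 + 2 + (1 + (1 + (1 + (2 * 62 + (1 + 1))))))))))))))).+2) _ Q) => //; last by lia.
apply: runs_seq; apply: runs_const; apply: runs_if; mem; last by rewrite rr // f1.
move=> _; do 19!rstep.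
(* The offset 1020 = 16 * 63 + 12 is slot 63 of [aOUT], whose entry belongs in cell 64. The copied
   cells end below [base], so the arrays survive. *)
set M1 := upd _ _ _.
have M1x x : 9 < x -> M1 x = M x by move=> *; rewrite /M1; mem.
apply: (@runs_copy_loop (base + 1020) 64 16 1 64 (size L + 2)); rewrite ?/M1;
  try (by mem; lia); try (by move=> *; lia); try lia.
rewrite -/M1 => M2 cs co.
have M2x x : 9 < x -> x < 64 \/ base <= x -> M2 x = M x.
  by move=> x9 hx; rewrite co ?M1x //; [rewrite !inE; lia|move=> i; lia].
have c32 : M2 32 = base by rewrite M2x //; left.
do 2!rstep.
apply: runs_seq; apply: runs_add_eq; [mem; exact: c32|by mem|].
do 3!rstep.
set M3 := upd _ _ _.
have M3x x : 9 < x -> M3 x = M2 x by move=> *; rewrite /M3; mem.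
apply: (@runs_fetch _ _ (base + 12)); rewrite ?/M3; try (by mem; lia); try lia.
rewrite -/M3 => M4 z0 fs fo.
have oM i : M3 (base + 12 + 16 * i) = s.2 aOUT i.
  rewrite M3x; last by lia.
  rewrite M2x; [rewrite -ra //; congr M; lia|lia|lia].
apply: runs_seq; apply: (@runs_load_eq _ _ _ (base + 12 + 16 * 62) (size L)).
  by rewrite z0.
  by rewrite fo; [rewrite oM|lia|move=> i; lia].
rstep; apply: hQ; first by mem.
apply: (@eq_from_nth _ 0); first by rewrite size_mkseq; mem.
move=> i; rewrite size_mkseq; mem => il; rewrite nth_mkseq //; mem.
have := oj i il; have [i62|i62] := ltnP i 62.
  by rewrite addn0 -add2n fs // oM.
move=> <-.
rewrite fo; [|by lia|by move=> j; lia].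
rewrite M3x; last by lia.
have -> : i.+2 = 64 + 1 * (i - 62) by lia.
rewrite cs; last by lia.
rewrite M1x; last by lia.
by rewrite -ra //; congr M; lia.
Qed.

(** * The complete program *)

Definition core : cmd :=
  pack ;; scan ;; relocate ;; unpack ;; compile decide_rank 33 ;; finish.

Definition transversal_rank_prog : cmd :=
  CIf 2 1 (CConst 0 0) (CConst 0 1 ;; CIf 2 0 CSkip core).

Lemma runs_core (ws : seq (seq nat)) k m T Tf M (Q : memory -> Prop) :
  all (fun w => 0 < size w) ws -> 0 < m -> k <= m -> M 1 = k -> M 2 = m ->
  (forall i, i <= size (stream ws) -> M (3 + i) = nth 0 (stream ws) i) ->
  (forall s, s.1 rk = k -> s.1 rm = m -> rep_stream ws s ->
     tri decide_rank s T (fun s' => forall M',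
       stored (67 + size (stream ws)) s' M' -> runs finish M' Tf Q)) ->
  runs core M (8 * m + 6 * size ws + 7 * size (stream ws) + T + Tf + 209) Q.
Proof.
move=> ne m0 km h1 h2 hS hT; set len := size (stream ws) in hS hT *.
apply: (@runs_weaken _ _ (4 * m + ((6 * size ws + 5) + ((7 * len + 200) +
   ((4 * m + 4) + (T + Tf))))) _ Q) => //; last by lia.
apply: runs_seq; apply: (runs_pack m0 h1 h2) => M1 p1 px.
apply: runs_seq; apply: (runs_scan ne) => [i il|M2 s0 sx]; first by rewrite px ?hS.
apply: runs_seq; apply: (runs_relocate s0) => [i il|M3 r32 r1 rS].
  by rewrite sx // px ?hS.
apply: runs_seq; apply: (runs_unpack km (_ : M3 1 = _)); first by rewrite r1 sx.
move=> M4 u1 u2 ux.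
(* The arrays are defined as whatever lies above the base, so the memory represents a state without
   any initialisation. *)
pose s : state := (M4, fun a i => M4 (67 + len + 16 * i + a)).
have rs : stored (67 + len) s M4 by split=> //; rewrite ux.
have [cT hq] : tri decide_rank s T (fun s' => forall M', stored (67 + len) s' M' -> runs finish M' Tf Q).
  apply: hT => // i il; rewrite /s /= addn0 ux ?rS //.
apply: runs_seq.
apply: (runs_weaken (comp_ok _ _ fits_decide_rank rs) cT) => // M5 [r5 _].
exact: hq (agree_hrun _ _) _ r5.
Qed.

(** Sending a vertex to a private edge is injective. This justifies rejecting k > m, and thereby the
    packing of (k, m). *)
Lemma critical_nverts n m mm t : critical n m mm t -> nverts n t <= m.
Proof.
move=> ct; rewrite nvertsE.
pose pe v := find (fun e => mm e v && (cnt n mm t e <= 1)) (iota 0 m).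
have peP v : v < n -> t v -> [/\ pe v < m, mm (pe v) v & cnt n mm t (pe v) <= 1].
  move=> vN tv; have h : has (fun e => mm e v && (cnt n mm t e <= 1)) (iota 0 m).
    have [e em he] := ct v vN tv.
    by apply/hasP; exists e => //; rewrite mem_iota.
  have := nth_find 0 h; have := h; rewrite has_find size_iota => lt.
  by rewrite nth_iota // add0n => /andP [].
rewrite -(size_map pe) -[X in _ <= X](size_iota 0); apply: uniq_leq_size.
  rewrite map_inj_in_uniq ?filter_uniq ?iota_uniq // => v w.
  rewrite !mem_filter !mem_iota => /andP [tv vn] /andP [tw wn] e.
  have [_ mv c] := peP v vn tv; have [_ mw _] := peP w wn tw.
  by apply: cnt_le1 c vn wn tv mv tw _; rewrite e.
move=> e /mapP [v]; rewrite mem_filter mem_iota => /andP [tv vn] ->.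
by have [h _ _] := peP v vn tv; rewrite mem_iota.
Qed.

(** * Hypergraphs and incidence predicates *)

Definition rows n (es : seq (seq 'I_n)) : seq (seq nat) :=
  [seq map (@nat_of_ord n) e | e <- es].
Definition edge n (es : seq (seq 'I_n)) e : {set 'I_n} := [set x in nth [::] es e].
Definition incident n (es : seq (seq 'I_n)) e v : bool := v \in row (rows es) e.
Definition indic n (T : {set 'I_n}) v : bool :=
  if insub v is Some x then x \in T else false.

Lemma indicE n (T : {set 'I_n}) (x : 'I_n) : indic T x = (x \in T).
Proof. by rewrite /indic valK. Qed.

Lemma size_rows n (es : seq (seq 'I_n)) : size (rows es) = size es.
Proof. exact: size_map. Qed.

Lemma row_rows n (es : seq (seq 'I_n)) e :
  row (rows es) e = map (@nat_of_ord n) (nth [::] es e).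
Proof.
have [lt|ge] := ltnP e (size es); first by rewrite (nth_map [::]).
by rewrite !nth_default ?size_rows.
Qed.

Lemma incidentE n (es : seq (seq 'I_n)) e (x : 'I_n) :
  incident es e x = (x \in edge es e).
Proof. by rewrite /incident row_rows mem_map ?inE //; exact: val_inj. Qed.

Lemma encode_inputE n k (es : seq (seq 'I_n)) :
  encode_input k es = [:: n; k; size es] ++ stream (rows es).
Proof.
rewrite /encode_input /stream /rows -map_comp; congr (_ ++ flatten _).
by apply: eq_map => e /=; rewrite size_map.
Qed.

Lemma small_rows_rows n (es : seq (seq 'I_n)) : all uniq es -> small_rows n (rows es).
Proof.
move=> ue j; rewrite row_rows; split; last by move=> v /mapP [x _ ->].
rewrite size_map -[X in _ <= X]card_ord.
have [lt|ge] := ltnP j (size es); last by rewrite nth_default.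
by rewrite -(card_uniqP _) ?max_card //; exact: (all_nthP [::] ue).
Qed.

Lemma nverts_indic n (T : {set 'I_n}) : nverts n (indic T) = #|T|.
Proof.
rewrite -sum1_card [RHS]big_mkcond; apply: eq_bigr => v _.
by rewrite indicE; case: (v \in T).
Qed.

Lemma cnt_indic n (es : seq (seq 'I_n)) (T : {set 'I_n}) e :
  cnt n (incident es) (indic T) e = #|T :&: edge es e|.
Proof.
rewrite -sum1_card [RHS]big_mkcond; apply: eq_bigr => v _.
by rewrite indicE incidentE in_setI; case: (_ && _).
Qed.

Lemma represents_edge n (es : seq (seq 'I_n)) H (E : {set 'I_n}) : represents es H ->
  E \in H <-> exists2 e, e < size es & E = edge es e.
Proof.
move=> [_ _ ->]; rewrite inE; split=> [/mapP [s /(nthP [::]) [e em <-] ->]|[e em ->]].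
  by exists e.
by apply/mapP; exists (nth [::] es e) => //; exact: mem_nth.
Qed.

Lemma represents_card n (es : seq (seq 'I_n)) H : represents es H -> #|H| = size es.
Proof. by move=> [_ u ->]; rewrite cardsE (card_uniqP u) size_map. Qed.

Lemma hitting_indic n (es : seq (seq 'I_n)) H (T : {set 'I_n}) : represents es H ->
  hitting H T <-> hits n (size es) (incident es) (indic T).
Proof.
move=> rep; split=> [h e em|h E /(represents_edge _ rep) [e em ->]].
  rewrite cnt_indic card_gt0; apply: h; apply/(represents_edge _ rep); by exists e.
by rewrite -card_gt0 -cnt_indic; exact: h.
Qed.

(** If x has no private edge, removing x still leaves a hitting set. Conversely, a hitting proper
    subset that omits x needs another element in the private edge of x, which then has two. *)
Lemma minimal_hitting_indic n (es : seq (seq 'I_n)) H (T : {set 'I_n}) : represents es H ->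
  minimal_hitting H T <->
  hits n (size es) (incident es) (indic T) /\ critical n (size es) (incident es) (indic T).
Proof.
move=> rep; rewrite /minimal_hitting (hitting_indic T rep); split=> -[hT b]; split=> //.
- move=> v vn; rewrite -[v]/(nat_of_ord (Ordinal vn)); set x := Ordinal vn; rewrite indicE => xT.
  have [/existsP [e he]|no] :=
    boolP [exists e : 'I_(size es), incident es e x && (cnt n (incident es) (indic T) e <= 1)].
    by exists e => //; exact: ltn_ord.
  exfalso; apply: (b (T :\ x)); first exact: properD1.
  apply/(hitting_indic _ rep) => e em; have := hT e em; rewrite !cnt_indic => he.
  have := existsPn no (Ordinal em); rewrite incidentE cnt_indic negb_and -ltnNge /= => /orP h.
  rewrite setIDAC; case: h => h.
    by rewrite (setDidPl _) // disjoint_sym disjoints1 inE negb_and h orbT.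
  by move: h; rewrite (cardsD1 x); case: (x \in _) => //=; rewrite add0n; exact: ltnW.
- move=> T' /properP [sub [x xT xT']] /(hitting_indic _ rep) hT'.
  have [e em] := b x (ltn_ord x) (etrans (indicE T x) xT).
  rewrite incidentE cnt_indic => /andP [xe c1].
  have := hT' e em; rewrite cnt_indic card_gt0 => /set0Pn [y]; rewrite in_setI => /andP [yT' ye].
  have yx : y != x by apply/eqP => e1; move: xT'; rewrite -e1 yT'.
  have : [set x; y] \subset T :&: edge es e.
    by apply/subUsetP; split; rewrite sub1set in_setI; apply/andP; split=> //; exact: (subsetP sub).
  by move/subset_leq_card; rewrite cards2 eq_sym yx; lia.
Qed.

(** Double counting: the inner sum is the degree of [v], as distinct lists represent distinct
    edges. *)
Lemma sum_incident n (es : seq (seq 'I_n)) H : represents es H ->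
  \sum_(v < n) \sum_(e < size es) incident es e v <= n * hmaxdeg H.
Proof.
move=> rep; rewrite -[X in X * _]card_ord -sum_nat_const; apply: leq_sum => v _.
apply: leq_trans (leq_bigmax v).
case: rep => [_ u ->]; set S := [seq [set x in e] | e <- es] in u *.
rewrite /hdeg; have -> : [set E in [set E in S] | v \in (E : {set 'I_n})] =
      [set E in [seq E : {set 'I_n} <- S | v \in E]].
  by apply/setP => E; rewrite !inE mem_filter andbC.
rewrite cardsE (card_uniqP _) ?filter_uniq // size_filter /S count_map -sum1_count.
rewrite [X in _ <= X]big_mkcond (big_nth [::]) big_mkord; apply: leq_sum => e _.
by rewrite incidentE /edge /= !inE; case: (v \in _).
Qed.

(** Pays for reading the input. For k >= 2 the bound could only collapse if Delta = 0, but then all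
    edges are empty, whereas there are at least two distinct ones. *)
Lemma time_bound_ge n (es : seq (seq 'I_n)) H k : represents es H ->
  0 < size es -> k <= size es ->
  size es * maxn n 1 <= time_bound n (size es) (hmaxdeg H) k + 1.
Proof.
move=> rep m0 km; have [_ u _] := rep.
case: (posnP n) => [n0|n0].
  (* Without vertices the empty set is the only possible edge. *)
  have : size es <= 1.
    have := @uniq_leq_size _ _ [:: set0] u; rewrite size_map; apply => E _.
    by rewrite inE; apply/eqP/setP => x; have h := ltn_ord x; exfalso; lia.
  by rewrite (_ : maxn n 1 = 1) ?muln1; lia.
rewrite (maxn_idPl n0) /time_bound; case: ifP => k2; last by lia.
suff D0 : 0 < hmaxdeg H.
  have X1 : size es <= hmaxdeg H ^ (k - 2) * size es by rewrite leq_pmull // expn_gt0 D0.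
  have X2 : n <= n ^ (k - 1) by rewrite -{1}(expn1 n) leq_pexp2l //; lia.
  by apply: leq_trans (leq_mul X1 X2) _; lia.
rewrite lt0n; apply/eqP => D0.
have emp e : e < size es -> edge es e = set0.
  move=> em; apply/setP => x; rewrite [RHS]inE; apply/negbTE/negP => xe.
  have eH : edge es e \in H by apply/(represents_edge _ rep); exists e.
  have : hdeg H x <= hmaxdeg H by exact: (leq_bigmax x).
  rewrite D0 leqn0 cards_eq0 => /eqP /setP /(_ (edge es e)).
  by rewrite in_set eH xe in_set0.
have m2 : 1 < size es by exact: leq_trans k2 km.
have := nth_uniq set0 (s := [seq [set x in e] | e <- es]) (i := 0) (j := 1).
rewrite size_map => /(_ m0 m2 u); rewrite !(nth_map [::]) //.
by rewrite -![[set x in nth _ _ _]]/(edge es _) !emp ?eqxx.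
Qed.

Definition transversal_pred n m mm k t : Prop :=
  [/\ hits n m mm t, critical n m mm t & k <= nverts n t].

Lemma minimal_hitting_pred n (es : seq (seq 'I_n)) H k t : represents es H ->
  transversal_pred n (size es) (incident es) k t ->
  minimal_hitting H [set x : 'I_n | t x] /\ k <= #|[set x : 'I_n | t x]|.
Proof.
move=> rep [h c kt]; set T := [set x : 'I_n | t x].
have tT v : v < n -> indic T v = t v.
  by move=> vn; rewrite -[v]/(nat_of_ord (Ordinal vn)) indicE inE.
have cT e : cnt n (incident es) (indic T) e = cnt n (incident es) t e.
  by apply: eq_bigr => v _; rewrite tT.
split; last by rewrite -nverts_indic; apply: leq_trans kt _; apply: leq_sum => v _; rewrite tT.
apply/(minimal_hitting_indic _ rep); split=> [e em|v vn]; first by rewrite cT; exact: h.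
by rewrite tT // => tv; have [e em he] := c v vn tv; exists e; rewrite ?cT.
Qed.

Lemma rank_pred n (es : seq (seq 'I_n)) H k : represents es H ->
  transversal_rank_ge H k <->
  exists t, transversal_pred n (size es) (incident es) k t.
Proof.
move=> rep; split=> [[T [/(minimal_hitting_indic _ rep) [h c] kT]]|[t tp]].
  by exists (indic T); split; rewrite ?nverts_indic.
by have [mT kT] := minimal_hitting_pred rep tp; exists [set x : 'I_n | t x].
Qed.

Lemma correct_accept n (es : seq (seq 'I_n)) H k t M : represents es H ->
  transversal_pred n (size es) (incident es) k t -> M 0 = 1 ->
  output_set M = [seq v <- iota 0 n | t v] -> correct_output k H M.
Proof.
move=> rep tp M0 out; split; first by left.
split; first by split=> // _; apply/(rank_pred _ rep); exists t.
move=> _; exists [set x : 'I_n | t x]; rewrite out.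
have [mT kT] := minimal_hitting_pred rep tp; split=> //.
- by rewrite filter_uniq // iota_uniq.
- by move=> x; rewrite mem_filter mem_iota => /andP [].
- by apply/setP => x; rewrite !inE mem_filter mem_iota /= ltn_ord andbT.
Qed.

Lemma correct_reject n (es : seq (seq 'I_n)) H k M : represents es H ->
  ~ (exists t, transversal_pred n (size es) (incident es) k t) -> M 0 = 0 ->
  correct_output k H M.
Proof.
move=> rep no M0; split; first by right.
by split; rewrite M0 //; split=> // /(rank_pred _ rep).
Qed.

Lemma size_stream_le n (es : seq (seq 'I_n)) f : all uniq es ->
  size (stream (take f (rows es))) <= size es * (n + 1).
Proof.
move=> ue; apply: leq_trans (_ : size (stream (rows es)) <= _).
  by rewrite -{2}(cat_take_drop f (rows es)) /stream map_cat flatten_cat size_cat leq_addr.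
rewrite /stream size_flatten /shape -map_comp sumnE big_map /rows big_map.
rewrite -sum1_size big_distrl /= big_seq [X in _ <= X]big_seq; apply: leq_sum => e ein.
rewrite size_map mul1n addn1 ltnS.
rewrite -[X in _ <= X]card_ord -(card_uniqP (allP ue _ ein)); exact: max_card.
Qed.

Lemma runs_prog n (es : seq (seq 'I_n)) H k : represents es H ->
  runs transversal_rank_prog (init_mem (encode_input k es))
    (1000 * 100 * (time_bound n #|H| (hmaxdeg H) k + 1)) (correct_output k H).
Proof.
move=> rep; rewrite (represents_card rep); have [ue _ _] := rep.
set M0 := init_mem _; set m := size es.
have M1 : M0 1 = k by rewrite /M0 encode_inputE.
have M2 : M0 2 = m by rewrite /M0 encode_inputE.
have M3 i : M0 (3 + i) = nth 0 (stream (rows es)) i by rewrite /M0 encode_inputE.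
set Y := time_bound n m _ k + 1; have Y1 : 1 <= Y by rewrite /Y addn1.
have [Z ZE] : exists Z, Z = 1000 * 90 * Y by eexists.
apply: (@runs_weaken _ _ (4 + Z).+2 _ (correct_output k H)) => //; last by lia.
apply: runs_if; rewrite M1 M2 => km.
  apply: (@runs_weaken _ _ 1 _ (correct_output k H)) => //.
  apply: runs_const; apply: (correct_reject rep); last by mem.
  by move=> [t [_ c kt]]; have := critical_nverts c; rewrite -/m; lia.
apply: (@runs_weaken _ _ (1 + Z.+2) _ (correct_output k H)) => //.
apply: runs_seq; apply: runs_const; apply: runs_if; mem; rewrite M2 => m0.
  (* Now k = m = 0 and the empty set is the answer; cell 1 still holds k = 0, which is read as the
     output size. *)
  have mz : m = 0 by lia.
  apply: (@runs_weaken _ _ 0 _ (correct_output k H)) => //; apply: runs_skip.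
  apply: (correct_accept rep (t := fun=> false)); last first.
  - by rewrite /output_set; mem; rewrite M1 (_ : k = 0) ?filter_pred0 //; lia.
  - by mem.
  - by split; rewrite /hits /critical -/m ?mz //; lia.
have tb := time_bound_ge rep m0 km; rewrite -/m -/Y in tb.
pose f := find (fun w => size w == 0) (rows es).
pose ws := take f (rows es).
have fm : f <= m by rewrite /m -(size_rows es); exact: find_size.
have sw : size ws = f by rewrite size_takel // size_rows.
have nonempty : all (fun w => 0 < size w) ws.
  apply/(all_nthP [::]) => i; rewrite sw => i_f; rewrite nth_take // lt0n.
  by have := before_find [::] i_f => /negbT.
(* The terminator is the size of the first empty edge, or else a cell beyond the input. *)
have hS i : i <= size (stream ws) -> upd M0 0 1 (3 + i) = nth 0 (stream ws) i.
  move=> il; rewrite upd_neq // M3.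
  have -> : stream (rows es) = stream ws ++ stream (drop f (rows es)).
    by rewrite -flatten_cat -map_cat cat_take_drop.
  rewrite nth_cat; move: il; rewrite leq_eqVlt => /orP [/eqP ->|->] //.
  rewrite ltnn subnn [RHS]nth_default //.
  have [fs|fs] := ltnP f (size (rows es)); last by rewrite drop_oversize.
  rewrite (drop_nth [::] fs) /=.
  by have := @nth_find _ [::] (fun w => size w == 0) (rows es); rewrite has_find => /(_ fs) /eqP.
pose n' := maxn n 1.
have n'0 : 0 < n' by rewrite /n'; lia.
have mY : m <= Y by apply: leq_trans tb; rewrite leq_pmulr.
have nY : n <= Y by apply: leq_trans tb; apply: leq_trans (_ : n' <= _); rewrite ?leq_pmull ?leq_maxl.
have lenY : size (stream ws) <= 2 * Y.
  apply: leq_trans (size_stream_le f ue) _.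
  apply: leq_trans (_ : m * (2 * n') <= _); first by rewrite leq_mul2l /n'; lia.
  by rewrite mulnCA leq_mul2l tb.
have mk1 : upd M0 0 1 1 = k by mem.
have mk2 : upd M0 0 1 2 = m by mem.
move: fm; rewrite leq_eqVlt => /orP [/eqP fe|fm].
- have wE : ws = rows es by rewrite /ws fe -[m](size_rows es) take_size.
  pose b := \sum_(v < n) \sum_(e < m) incident es e v.
  (* The claimed bound appears here, from b <= n Delta. *)
  have bT : b ^ (k - 2) * (m * n) <= Y.
    have := sum_incident rep; rewrite -/m -/b => bD; rewrite /Y /time_bound.
    case: ifP => k2; last by rewrite (_ : k - 2 = 0) ?expn0 ?mul1n; lia.
    rewrite (_ : k - 1 = (k - 2).+1); last by lia.
    apply: leq_trans (_ : (n * hmaxdeg H) ^ (k - 2) * (m * n) <= _).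
      by rewrite leq_mul2r; case: (k - 2) => [|q]; rewrite ?expn0 ?leqnn ?leq_exp2r ?bD ?orbT.
    by rewrite expnMn expnSr; apply: leq_trans (leq_addr _ _); apply/eq_leq; lia.
  apply: (@runs_weaken _ _ (8 * m + 6 * size ws + 7 * size (stream ws) +
     4600 * (b ^ (k - 2) * (10 * (m * n))) + (7 * n + 200) + 209) _ (correct_output k H)) => //; last first.
    rewrite sw (_ : b ^ (k - 2) * (10 * (m * n)) = 10 * (b ^ (k - 2) * (m * n))); last by rewrite mulnCA.
    by lia.
  apply: (runs_core nonempty m0 km mk1 mk2 hS) => s sk sm rS.
  set len := size (stream ws).
  have := @tri_decide_rank (rows es) n k s (fun s' => forall M',
    stored (67 + len) s' M' -> runs finish M' (7 * n + 200) (correct_output k H)).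
  cbv zeta; rewrite size_rows -/m; apply => //.
  - by rewrite -wE.
  - exact: small_rows_rows.
  - by rewrite -wE.
  move=> s' [[f0 no]|[f1 [t [ht ct kt [zL oL oj]]]]] M' r.
    apply: (runs_finish_reject _ r f0) => M4; exact: (correct_reject rep no).
  apply: (runs_finish_accept _ r f1 _ _ zL oL oj) => //.
  (* Each vertex of the output lies in an edge, hence occurs in the stream, so the output fits below
     the base [67 + len]. *)
  + set L := [seq v <- iota 0 n | t v].
    suff : size L <= len by lia.
    apply: uniq_leq_size; first by rewrite filter_uniq // iota_uniq.
    move=> v; rewrite mem_filter mem_iota => /andP [tv vn].
    have [e em /andP [ve _]] := ct v vn tv.
    apply/flatten_mapP; exists (row ws e); last by rewrite inE wE ve orbT.
    by rewrite mem_nth // sw fe.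
  + by rewrite size_filter; apply: leq_trans (count_size _ _) _; rewrite size_iota.
  + by move=> M4 m4 o4; apply: (correct_accept rep _ m4 o4).
- apply: (@runs_weaken _ _ (8 * m + 6 * size ws + 7 * size (stream ws) +
     1000 * (m * n') + (7 * 0 + 200) + 209) _ (correct_output k H)) => //; last first.
    by rewrite sw; lia.
  apply: (runs_core nonempty m0 km mk1 mk2 hS) => s sk sm rS.
  apply: (tri_decide_rank_empty_row nonempty _ sm rS n'0); first by rewrite sw.
  move=> s' f0 M' r; apply: (runs_finish_reject _ r f0) => M4; apply: (correct_reject rep).
  (* Edge [f] is empty, so nothing hits it. *)
  move=> [t [ht _ _]]; have /cnt_gt0 [v [_ _]] := ht f fm.
  have := @nth_find _ [::] (fun w => size w == 0) (rows es); rewrite has_find size_rows => /(_ fm).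
  by rewrite /incident => /nilP ->.
Qed.

Theorem theorem1 :
  exists (p : program) (C : nat),
    forall (n : nat) (H : {set {set 'I_n}}) (es : seq (seq 'I_n)) (k : nat),
      represents es H ->
      exists (t : nat) (M : memory),
        [/\ t <= C * (time_bound n #|H| (hmaxdeg H) k + 1),
            run p t (0, init_mem (encode_input k es)) = Some M &
            correct_output k H M].
Proof.
exists (code transversal_rank_prog 0), (1000 * 100) => n H es k rep.
by have [t [M [/run_code e le q]]] := runs_prog k rep; exists t, M.
Qed.
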